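(* Let $n\ge 5$ and $k\ge 0$ be integers. For every $G\in\mathcal{C}(n,k)$ we have $$Sz_{e}(G)\ \ge\ 2kn+2k^{2}-5k,$$ $$Sz_{ev}(G)\ \ge\ \tfrac12\,(n^{2}-3n+3kn-5k+2),$$ and in each of the two inequalities equality holds if and only if $G\cong C_{0}(n,k)$.
   Context: Graphs are finite, simple and connected. For a connected graph $G$ and vertices $u,v$, $d_G(u,v)$ is the distance; for an edge $f=xy$ and a vertex $w$, $d_G(f,w)=\min\{d_G(x,w),d_G(y,w)\}$. For an edge $e=uv$ of $G$: $n_u(e|G)$ is the number of vertices $w$ with $d_G(u,w)<d_G(v,w)$ and $n_v(e|G)$ the number with $d_G(v,w)<d_G(u,w)$; $m_u(e|G)$ is the number of edges $f$ with $d_G(f,u)<d_G(f,v)$ and $m_v(e|G)$ the number with $d_G(f,v)<d_G(f,u)$. The edge Szeged index is $Sz_e(G)=\sum_{uv\in E(G)} m_u(uv|G)\,m_v(uv|G)$ and the edge-vertex Szeged index is $Sz_{ev}(G)=\frac12\sum_{uv\in E(G)}[n_u(uv|G)m_v(uv|G)+n_v(uv|G)m_u(uv|G)]$. A cactus is a connected graph in which every block is either a cut edge or a cycle (equivalently, any two cycles have at most one common vertex). $\mathcal{C}(n,k)$ is the class of all cacti with $n$ vertices and exactly $k$ cycles. $C_0(n,k)\in\mathcal{C}(n,k)$ is the graph formed by $k$ triangles all sharing one common vertex (and otherwise disjoint), with $n-2k-1$ pendant edges attached at that common vertex (for $k=0$ it is the star on $n$ vertices). *)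

(* Defs.v *)
From HB Require Import structures.
From mathcomp Require Import all_boot all_order all_algebra.

Set Implicit Arguments.
Unset Strict Implicit.
Unset Printing Implicit Defensive.

Import Order.TTheory GRing.Theory Num.Theory.

Record sgraph := SGraph {
  vertex :> finType;
  adj : rel vertex;
  adj_sym : symmetric adj;
  adj_irrefl : irreflexive adj }.

Definition isomorphic (G H : sgraph) : Prop :=
  exists2 f : G -> H, bijective f & forall x y, adj (f x) (f y) = adj x y.

Section Graph.
Variable G : sgraph.
Implicit Types (u v w x y : G) (f : {set G}) (A B : {set G}) (r : rel G).

Definition edges : {set {set G}} :=
  [set f : {set G} | [exists x, exists y, adj x y && (f == [set x; y])]].

Definition has_walk u v (l : nat) : bool :=
  [exists p : l.-tuple G, path (@adj G) u p && (last u p == v)].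

(* A shortest walk repeats no vertex, so its length is below #|G|; the value
   #|G| is only taken when v is not reachable from u. *)
Definition dist u v : nat :=
  \big[minn/#|G|]_(l < #|G| | has_walk u v l) l.

Definition edist f w : nat := \big[minn/#|G|]_(x in f) dist x w.

(* For an edge e = uv, n_u(e|G) is nv u v and n_v(e|G) is nv v u;
   similarly for me. *)
Definition nv u v : nat := #|[set w | dist u w < dist v w]|.
Definition me u v : nat := #|[set f in edges | edist f u < edist f v]|.

(* The condition on enum_rank selects one of the two orientations of each edge;
   the choice is immaterial because both summands are symmetric in u and v. *)
Definition Sz_e : nat :=
  \sum_(u : G) \sum_(v : G | adj u v && (enum_rank u < enum_rank v))
    me u v * me v u.

Definition Sz_ev : rat :=
  ((\sum_(u : G) \sum_(v : G | adj u v && (enum_rank u < enum_rank v))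
      (nv u v * me v u + nv v u * me u v))%N%:R / 2)%R.

(* Connectedness of the graph induced by r on A. *)
Definition connected_on r A : bool :=
  [forall x in A, forall y in A,
     connect [rel u v | [&& u \in A, v \in A & r u v]] x y].

Definition connected : bool := connected_on (@adj G) setT.

(* Cycles are counted as subgraphs, represented by their edge sets. *)
Definition cycle_edges (s : seq G) : {set {set G}} :=
  [set [set x; next s x] | x in s].

Definition cycles : {set {set {set G}}} :=
  [set C | [exists l : 'I_#|G|.+1, exists s : l.-tuple G,
     [&& 2 < l, ucycleb (@adj G) s & C == cycle_edges s]]].

Definition nonseparable B : bool :=
  connected_on (@adj G) B && [forall v in B, connected_on (@adj G) (B :\ v)].

(* A maximal connected subgraph without cut vertex is an induced subgraph, so
   blocks are represented by their vertex sets. *)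
Definition block B : bool := maxset nonseparable B.

Definition cut_edge f : bool :=
  (f \in edges) &&
  ~~ connected_on [rel u v | adj u v && ([set u; v] != f)] setT.

Definition induced_edges B : {set {set G}} := [set f in edges | f \subset B].

Definition induces_cycle B : bool :=
  (cover (induced_edges B) == B) && (induced_edges B \in cycles).

Definition cactus : Prop :=
  connected /\ forall B, block B -> cut_edge B \/ induces_cycle B.

End Graph.

Definition cactus_class (n k : nat) (G : sgraph) : Prop :=
  [/\ cactus G, #|G| = n & #|cycles G| = k].

(* None is the common vertex; Some (inl (i, b)), b : bool, are the two other
   vertices of the i-th triangle; Some (inr j) are the pendant vertices.
   The truncated subtraction is harmless: a graph in cactus_class n k has
   2 * k + 1 <= n. *)
Definition C0_vertex (n k : nat) : finType :=
  option ('I_k * bool + 'I_(n - 2 * k - 1)).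

Definition C0_adj (n k : nat) : rel (C0_vertex n k) :=
  fun x y => match x, y with
  | None, Some _ | Some _, None => true
  | Some (inl (i, b)), Some (inl (j, c)) => (i == j) && (b != c)
  | _, _ => false
  end.

Lemma C0_sym n k : symmetric (@C0_adj n k).
Proof.
by move=> [[[i b]|i]|] [[[j c]|j]|] //=; rewrite eq_sym [c == b]eq_sym.
Qed.

Lemma C0_irrefl n k : irreflexive (@C0_adj n k).
Proof. by move=> [[[i b]|i]|] //=; rewrite !eqxx. Qed.

Definition C0 (n k : nat) : sgraph := SGraph (@C0_sym n k) (@C0_irrefl n k).

(* Main.v *)
Require Import Defs.
From HB Require Import structures.
From mathcomp Require Import all_boot all_order all_algebra zify ring.
Import Order.TTheory GRing.Theory Num.Theory.
Set Implicit Arguments.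
Unset Strict Implicit.
Unset Printing Implicit Defensive.

(** Let G be a cactus with n vertices, m edges and k cycles. Its cycles are
    pairwise edge-disjoint and m = n - 1 + k, so both indices can be bounded
    block by block: an edge lies either in exactly one cycle or in none, and an
    edge of the latter kind is a bridge ([sum_over_blocks]).

    The geometric input is that a cycle C of length L is gated: once its edges
    are removed, its vertices lie in distinct components, so every vertex w sees
    C through a single vertex x, and dist w grows along C like min(t, L - t),
    where t is the position counted from x ([dist_cycle]). Hence w is
    equidistant from the ends of exactly one edge of C when L is odd and of none
    when L is even. The same holds for an edge in place of w, except that for
    even L an edge of C is equidistant from the ends of two edges of C, itself
    and the opposite one. Summing over C determines the sum over the edges uv of
    C of n_u + n_v and of m_u + m_v.

    For positive integers p q = (p + q - 1) + (p - 1)(q - 1). Applied to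
    m_u m_v, n_u m_v and n_v m_u along C, this gives at least 2 m - 3 for the
    edge index and at least 2 n - m - 3 for the excess over m - 1 per edge of
    twice the edge-vertex index; for L > 3 the bound is strict, which is where
    n >= 5 enters. A bridge contributes at least 0, respectively at least m - 1.
    The bounds add up to [Sz_e_bound] and [Sz_ev_bound].

    In both cases equality holds for all blocks iff every edge has a peripheral
    end, that is, a vertex of degree at most 2 whose neighbours are adjacent.
    A vertex all of whose neighbours are peripheral is adjacent to every other
    vertex, since its closed neighbourhood is closed under adjacency. So G then
    consists of pendant edges and triangles at one vertex, and m = n - 1 + k
    says that there are k triangles ([center_isomorphic]). *)

(** * Minima, pairs and sums over finite sets *)

Section BigMin.
Variables (I : eqType) (P : pred I) (F : I -> nat) (z : nat).
Implicit Type r : seq I.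

Lemma bigminn_leq r i : i \in r -> P i ->
  \big[minn/z]_(j <- r | P j) F j <= F i.
Proof.
elim: r => //= j r IHr; rewrite inE big_cons => /predU1P[<- -> | /IHr le_i Pi].
  exact: geq_minl.
by case: ifP => _; rewrite ?geq_min le_i ?orbT.
Qed.

Lemma bigminn_leq_idx r : \big[minn/z]_(j <- r | P j) F j <= z.
Proof. by elim/big_rec: _ => // i x _ le_x; rewrite geq_min le_x orbT. Qed.

Lemma bigminn_attained r :
  \big[minn/z]_(j <- r | P j) F j = z \/
  exists2 i, P i & \big[minn/z]_(j <- r | P j) F j = F i.
Proof.
elim/big_rec: _ => [|i x Pi IHx]; first by left.
by case: (leqP (F i) x) => _ //; right; exists i.
Qed.
End BigMin.

Lemma set2_eq (T : finType) (a b c d : T) :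
  [set a; b] = [set c; d] -> (a = c /\ b = d) \/ (a = d /\ b = c).
Proof.
move=> eq_s.
have /set2P[ac|ad] : a \in [set c; d] by rewrite -eq_s set21.
  have /set2P[da|] : d \in [set a; b] by rewrite eq_s set22.
    have /set2P[bc|bd] : b \in [set c; d] by rewrite -eq_s set22.
      by left; rewrite ac bc da ac.
    by left.
  by left.
have /set2P[ca|] : c \in [set a; b] by rewrite eq_s set21.
  have /set2P[bc|bd] : b \in [set c; d] by rewrite -eq_s set22.
    by right.
  by left; rewrite ca bd.
by right.
Qed.

Lemma card_set_sum (T : finType) (A : {set T}) (P : pred T) :
  #|[set x in A | P x]| = \sum_(x in A) P x.
Proof.
rewrite -sum1_card [RHS]big_mkcond [LHS]big_mkcond; apply: eq_bigr => x _.
by rewrite inE; case: (x \in A); case: (P x).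
Qed.

(** The source of both n_u + n_v + z = n and m_u + m_v + z' = m, where z and z'
    count the equidistant vertices and edges. *)
Lemma card_trichotomy (T : finType) (A : {set T}) (F1 F2 : T -> nat) :
  #|[set x in A | F1 x < F2 x]| + #|[set x in A | F2 x < F1 x]|
    + #|[set x in A | F1 x == F2 x]| = #|A|.
Proof.
rewrite -(sum1_card (mem A)) !card_set_sum -!big_split /=.
by apply: eq_bigr => x _; case: ltngtP.
Qed.

Lemma sum_card_exchange (S T : finType) (A : {set S}) (B : {set T})
    (R : S -> T -> bool) :
  \sum_(x in A) #|[set y in B | R x y]| = \sum_(y in B) #|[set x in A | R x y]|.
Proof.
under eq_bigr do rewrite card_set_sum; under [RHS]eq_bigr do rewrite card_set_sum.
exact: exchange_big.
Qed.

Lemma sum_Posz (I : finType) (A : {pred I}) (F : I -> nat) :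
  (\sum_(i in A) (F i)%:Z = (\sum_(i in A) F i)%N%:Z)%R.
Proof. by rewrite -natz natr_sum; apply: eq_bigr => i _; rewrite natz. Qed.

(** * Distances in a connected graph *)

Section Distance.
Variable G : sgraph.
Implicit Types (u v w x y : G) (p s : seq G) (f g : {set G}).

Lemma edgesP f :
  reflect (exists x y, adj x y /\ f = [set x; y]) (f \in edges G).
Proof.
rewrite inE; apply: (iffP existsP) => [[x /existsP[y /andP[xy /eqP->]]]|].
  by exists x, y.
by case=> x [y [xy ->]]; exists x; apply/existsP; exists y; rewrite xy eqxx.
Qed.

Lemma mem_edges x y : ([set x; y] \in edges G) = adj x y.
Proof.
apply/edgesP/idP => [[a [b [ab /set2_eq]]] | xy]; last by exists x, y.
by case=> [[-> ->]|[-> ->]] //; rewrite adj_sym.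
Qed.

Lemma adj_neq x y : adj x y -> x != y.
Proof. by apply: contraTneq => ->; rewrite adj_irrefl. Qed.

(** Walks of length #|G| or more are covered by the default value of the
    minimum that defines dist. *)
Lemma dist_walk u p : path (@adj G) u p -> dist u (last u p) <= size p.
Proof.
move=> up; case: (ltnP (size p) #|G|) => [ltp | lep]; last first.
  by apply: leq_trans lep; apply: bigminn_leq_idx.
apply: (@bigminn_leq _ _ _ _ _ (Ordinal ltp)); first exact: mem_index_enum.
by apply/existsP; exists (in_tuple p); rewrite up eqxx.
Qed.

Lemma dist_xx x : dist x x = 0.
Proof. by apply/eqP; rewrite -leqn0 (@dist_walk x [::]). Qed.

Lemma dist_adj x y : adj x y -> dist x y <= 1.
Proof. by move=> xy; apply: (@dist_walk x [:: y]); rewrite /= xy. Qed.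

Hypothesis conn : forall x y, connect (@adj G) x y.

Lemma shortest_walk u v :
  exists p, [/\ path (@adj G) u p, last u p = v & size p = dist u v].
Proof.
have /connectP[p0 up0 ->] := conn u v.
case/shortenP: up0 => p up uniq_p _.
have ltp: dist u (last u p) < #|G|.
  apply: leq_ltn_trans (dist_walk up) _.
  by have := uniq_leq_size uniq_p (fun x _ => mem_enum G x); rewrite -cardE.
have [dE | [l]] := bigminn_attained (fun l : 'I_#|G| => has_walk u (last u p) l)
  (@nat_of_ord _) #|G| (index_enum 'I_#|G|).
  by move: ltp; rewrite /dist dE ltnn.
case/existsP=> q /andP[uq /eqP last_q] dE.
by exists q; rewrite size_tuple last_q /dist dE.
Qed.

(** The tool for bounding distances from below: along a shortest walk a
    1-Lipschitz function increases by at most the length of the walk. *)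
Lemma dist_lipschitz (F : G -> nat) u v :
  (forall x y, adj x y -> F y <= F x + 1) -> F v <= F u + dist u v.
Proof.
move=> lipF; have [p [up <- <-]] := shortest_walk u v.
elim: p u up => [|x p IHp] u /=; first by rewrite addn0.
by case/andP=> /lipF ux /IHp; lia.
Qed.

Lemma dist_stepr u x y : adj x y -> dist u y <= dist u x + 1.
Proof.
move=> xy; have [p [up lp <-]] := shortest_walk u x.
by have := @dist_walk u (rcons p y); rewrite rcons_path up lp xy last_rcons
  size_rcons addn1; apply.
Qed.

Lemma dist_stepl u x y : adj x y -> dist y u <= dist x u + 1.
Proof.
move=> xy; have [p [xp lp <-]] := shortest_walk x u.
by have := @dist_walk y (x :: p); rewrite /= adj_sym xy xp lp addn1; apply.
Qed.

Lemma dist_sym u v : dist u v = dist v u.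
Proof.
have le u1 v1 : dist u1 v1 <= dist v1 u1.
  have := @dist_lipschitz (fun w => dist w v1) v1 u1; rewrite dist_xx add0n; apply.
  by move=> x y; apply: dist_stepl.
by apply/eqP; rewrite eqn_leq !le.
Qed.

Lemma dist_eq0 u v : (dist u v == 0) = (u == v).
Proof.
apply/eqP/eqP => [d0 | ->]; last exact: dist_xx.
by have [[|x p] [_ /= lp]] := shortest_walk u v; rewrite d0.
Qed.

Lemma dist_eq1 u v : adj u v -> dist u v = 1.
Proof.
move=> uv; apply/eqP; rewrite eqn_leq dist_adj //= lt0n dist_eq0.
exact: adj_neq.
Qed.

Lemma dist_gt1 u v : u != v -> ~~ adj u v -> 1 < dist u v.
Proof.
move=> neq_uv nadj; have [p [up lp <-]] := shortest_walk u v.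
case: p up lp => [_ eq_uv | x [/andP[ux _] /= xv|//]].
  by rewrite -eq_uv eqxx in neq_uv.
by rewrite -xv ux in nadj.
Qed.

Lemma dist_first u v : u != v ->
  exists2 x, adj u x & dist u v = (dist x v).+1.
Proof.
have [[|x p] [/= up lp sp]] := shortest_walk u v; first by rewrite lp eqxx.
case/andP: up => ux xp _.
exists x => //; apply/eqP; rewrite eqn_leq -addn1 dist_stepl 1?adj_sym //=.
by rewrite addn1 -sp ltnS -lp dist_walk.
Qed.

Lemma edist_leq f x w : x \in f -> edist f w <= dist x w.
Proof. by move=> xf; apply: bigminn_leq; first exact: mem_index_enum. Qed.

Lemma edist_attained f w : f != set0 -> exists2 x, x \in f & edist f w = dist x w.
Proof.
case/set0Pn=> x xf.
have [dE | //] := bigminn_attained (fun y => y \in f) (fun y => dist y w) #|G|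
  (index_enum G).
exists x => //; apply/eqP; rewrite eqn_leq edist_leq // /edist dE.
exact: bigminn_leq_idx.
Qed.

Lemma edge_neq0 f : f \in edges G -> f != set0.
Proof. by case/edgesP=> x [y [_ ->]]; apply/set0Pn; exists x; rewrite set21. Qed.

Lemma edist_set2 x y w : edist [set x; y] w = minn (dist x w) (dist y w).
Proof.
apply/eqP; rewrite eqn_leq leq_min !edist_leq ?set21 ?set22 //=.
have [|z /set2P zf ->] := @edist_attained [set x; y] w.
  by apply/set0Pn; exists x; rewrite set21.
by rewrite geq_min; case: zf => ->; rewrite leqnn ?orbT.
Qed.

Lemma edist_eq0 f w : f != set0 -> (edist f w == 0) = (w \in f).
Proof.
move=> nz; apply/idP/idP => [|wf]; last by rewrite -leqn0 -(dist_xx w) edist_leq.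
by have [x xf ->] := edist_attained w nz; rewrite dist_eq0 => /eqP <-.
Qed.

Lemma edist_step f x y : f != set0 -> adj x y -> edist f y <= edist f x + 1.
Proof.
move=> nz xy; have [z zf ->] := edist_attained x nz.
exact: leq_trans (edist_leq _ zf) (dist_stepr _ xy).
Qed.

Lemma edist_first f u : f != set0 -> u \notin f ->
  exists2 x, adj u x & edist f u = (edist f x).+1.
Proof.
move=> nz uf; have [z zf dz] := edist_attained u nz.
have /dist_first[x ux dx] : u != z by apply: contraNneq uf => ->.
exists x => //; apply/eqP; rewrite eqn_leq -addn1 edist_step 1?adj_sym //=.
by rewrite addn1 dz dist_sym dx ltnS dist_sym edist_leq.
Qed.
End Distance.

(** * Cycles as vertex lists *)

Section CycleLists.
Variable G : sgraph.
Implicit Types (u v w x y : G) (p s : seq G) (f g : {set G}).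
Implicit Types (C D : {set {set G}}).

Lemma cyclesP C :
  reflect (exists s, [/\ 2 < size s, ucycle (@adj G) s & C = cycle_edges s])
    (C \in cycles G).
Proof.
rewrite inE; apply: (iffP existsP) => [[l /existsP[s /and3P[lt2 us /eqP->]]]|].
  by exists s; rewrite size_tuple; split=> //; apply/andP.
case=> s [lt2 us ->]; have lts: size s < #|G|.+1.
  rewrite ltnS -(card_uniqP _) ?max_card //.
  by case/andP: us.
exists (Ordinal lts); apply/existsP; exists (in_tuple s).
by rewrite lt2 eqxx andbT; apply: us.
Qed.

Lemma cycle_edges_rot n s :
  uniq s -> cycle_edges (rot n s) = cycle_edges s.
Proof.
move=> us; apply/setP=> f; apply/imsetP/imsetP=> -[x xs ->]; exists x;
  by rewrite ?next_rot // ?mem_rot // mem_rot in xs *.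
Qed.

Lemma ucycle_rot n s :
  ucycle (@adj G) s -> ucycle (@adj G) (rot n s).
Proof. by case/andP=> cs us; apply/andP; rewrite rot_cycle rot_uniq. Qed.

Lemma ucycle_rebase s x : ucycle (@adj G) s -> x \in s ->
  exists p, [/\ ucycle (@adj G) (x :: p), (size p).+1 = size s,
    cycle_edges (x :: p) = cycle_edges s & s =i x :: p].
Proof.
move=> us /rot_to[i p def_s]; exists p; rewrite -def_s.
split; [exact: ucycle_rot | by rewrite -(size_rot i s) def_s | |].
  by apply: cycle_edges_rot; case/andP: us.
by move=> y; rewrite mem_rot.
Qed.

(** The list x :: p is read cyclically: for i = size p the index i.+1 is out of
    range, and the default value x of nth closes the cycle. *)
Definition step_edge x p i : {set G} :=
  [set nth x (x :: p) i; nth x (x :: p) i.+1].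

Lemma next_nth_cons x p i : uniq (x :: p) -> i <= size p ->
  next (x :: p) (nth x (x :: p) i) = nth x (x :: p) i.+1.
Proof. by move=> us lti; rewrite next_nth mem_nth // index_uniq. Qed.

Lemma cycle_edgesP x p f : uniq (x :: p) ->
  reflect (exists2 i, i <= size p & f = step_edge x p i)
    (f \in cycle_edges (x :: p)).
Proof.
move=> us; apply: (iffP imsetP) => [[y ys ->] | [i lei ->]].
  have lei : index y (x :: p) <= size p by have := ys; rewrite -index_mem.
  by exists (index y (x :: p)); rewrite // /step_edge -next_nth_cons ?nth_index.
exists (nth x (x :: p) i); first by rewrite mem_nth.
by rewrite next_nth_cons.
Qed.

Lemma step_edge_adj x p i : ucycle (@adj G) (x :: p) -> i <= size p ->
  adj (nth x (x :: p) i) (nth x (x :: p) i.+1).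
Proof.
case/andP=> cs us lei; rewrite -next_nth_cons //.
by apply: next_cycle => //; rewrite mem_nth.
Qed.

Lemma step_edge_last x p : step_edge x p (size p) = [set last x p; x].
Proof.
by rewrite /step_edge [nth x _ _.+1]nth_default // -last_nth.
Qed.

(** On a list of two vertices both steps are the same edge, hence 1 < size p. *)
Lemma step_edge_inj x p i j : uniq (x :: p) -> 1 < size p ->
  i <= size p -> j <= size p -> step_edge x p i = step_edge x p j -> i = j.
Proof.
move=> us lt1 lei lej; set s := x :: p.
have nthE a b : a <= size p -> b <= (size p).+1 -> nth x s a = nth x s b ->
    a = b \/ a = 0 /\ b = (size p).+1.
  move=> lea; rewrite leq_eqVlt => /predU1P[-> | ltb].
    rewrite [nth x s _.+1]nth_default // => /eqP.
    by rewrite -[x in _ == x]/(nth x s 0) nth_uniq // => /eqP->; right.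
  by move/eqP; rewrite nth_uniq // => /eqP->; left.
case/set2_eq=> -[e1 e2]; first by case: (nthE _ _ lei (leqW lej) e1); lia.
have := nthE i j.+1 lei lej e1; have := nthE j i.+1 lej lei (esym e2); lia.
Qed.

Lemma card_cycle_edges_pred x p (P : pred {set G}) :
  uniq (x :: p) -> 1 < size p ->
  #|[set f in cycle_edges (x :: p) | P f]| =
  #|[set i : 'I_(size p).+1 | P (step_edge x p i)]|.
Proof.
move=> us lt1; rewrite -(@card_in_imset _ _ (fun i : 'I__ => step_edge x p i)).
  apply: eq_card => f; rewrite inE; apply/andP/imsetP => [[]|[i]].
    case/cycle_edgesP=> // i lei -> Pi.
    by exists (Ordinal (lei : i < (size p).+1)); rewrite ?inE.
  by rewrite inE => Pi ->; split=> //; apply/cycle_edgesP => //;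
    exists i; rewrite // -ltnS ltn_ord.
move=> i j _ _ eqij; apply/val_inj/(step_edge_inj us lt1) => //.
  by rewrite -ltnS ltn_ord.
by rewrite -ltnS ltn_ord.
Qed.

Lemma card_cycle_edges x p : uniq (x :: p) -> 1 < size p ->
  #|cycle_edges (x :: p)| = (size p).+1.
Proof.
move=> us lt1; have := card_cycle_edges_pred predT us lt1.
rewrite (_ : [set f in _ | _] = cycle_edges (x :: p)).
  by move->; rewrite cardsT card_ord.
by apply/setP=> f; rewrite inE andbT.
Qed.

(** Any edge of a cycle can be made its closing edge by a rotation. *)
Lemma cycle_edge_based C f : C \in cycles G -> f \in C ->
  exists x p, [/\ ucycle (@adj G) (x :: p), 1 < size p, C = cycle_edges (x :: p)
                & f = [set last x p; x]].
Proof.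
case/cyclesP=> s [lt2 us ->] /imsetP[y ys ->].
have uniq_s : uniq s by case/andP: us.
have /rot_to[i p def_s] : next s y \in s by rewrite mem_next.
exists (next s y), p; rewrite -def_s cycle_edges_rot //.
split=> //; first exact: ucycle_rot.
  by rewrite -(size_rot i) def_s in lt2.
have uniq_p : uniq (next s y :: p) by rewrite -def_s rot_uniq.
suff -> : last (next s y) p = y by [].
have: prev (next s y :: p) (next s y) = y.
  by rewrite -[in X in prev _ X](next_rot i uniq_s) def_s prev_next.
rewrite prev_nth mem_head memNindex; last by case/andP: uniq_p.
by rewrite -last_nth.
Qed.

Lemma cycles_sub_edges C : C \in cycles G -> C \subset edges G.
Proof.
case/cyclesP=> s [_ /andP[cs _] ->]; apply/subsetP=> _ /imsetP[x xs ->].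
by rewrite mem_edges; apply: next_cycle.
Qed.

Lemma card_cycle_gt2 C : C \in cycles G -> 2 < #|C|.
Proof.
case/cyclesP=> -[[] // | x p [lt2 /andP[_ us] ->]].
by rewrite card_cycle_edges.
Qed.

End CycleLists.

(** * Cycles of a cactus are edge-disjoint *)

Section Nonseparable.
Variable G : sgraph.
Implicit Types (u v w x y : G) (p s : seq G) (f g : {set G}) (A B : {set G}).
Implicit Types (C D : {set {set G}}).

Let ind A := [rel u v : G | [&& u \in A, v \in A & adj u v]].

Lemma ind_sym A : connect_sym (ind A).
Proof. by apply: sym_connect_sym => x y /=; rewrite adj_sym andbCA. Qed.

Lemma connected_onP A :
  reflect {in A &, forall x y, connect (ind A) x y} (connected_on (@adj G) A).
Proof.
apply: (iffP forall_inP) => [cA x y xA yA | cA x xA].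
  by have /forall_inP/(_ y yA) := cA x xA.
by apply/forall_inP=> y yA; apply: cA.
Qed.

Lemma connected_onU A B z : z \in A -> z \in B ->
  connected_on (@adj G) A -> connected_on (@adj G) B ->
  connected_on (@adj G) (A :|: B).
Proof.
move=> zA zB /connected_onP cA /connected_onP cB; apply/connected_onP.
have sub (A' : {set G}) : A' \subset A :|: B ->
  subrel (connect (ind A')) (connect (ind (A :|: B))).
  move=> /subsetP sA; apply: connect_sub => x y /and3P[xA yA xy].
  by apply: connect1; rewrite /= !sA.
have toz x : x \in A :|: B -> connect (ind (A :|: B)) x z.
  by case/setUP=> xA; [apply: (sub A _); rewrite ?subsetUl ?cA
                      |apply: (sub B _); rewrite ?subsetUr ?cB].
move=> x y xAB yAB; apply: connect_trans (toz _ xAB) _.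
by rewrite ind_sym toz.
Qed.

Lemma connected_on_path x p :
  path (@adj G) x p -> connected_on (@adj G) [set y in x :: p].
Proof.
move=> xp; have xp' : path (ind [set y in x :: p]) x p.
  apply: (@sub_in_path _ (mem (x :: p)) _ _ _ _ _ _ xp).
    by move=> u v us vs uv; rewrite /= !inE; apply/and3P.
  by apply/allP.
apply/connected_onP=> u v; rewrite !inE => us vs.
apply: (@connect_trans _ _ x); last exact: (path_connect xp').
by rewrite ind_sym; apply: (path_connect xp').
Qed.

(** After deletion of any vertex, one of the two common vertices x and y is left
    to connect the remains of A and B. *)
Lemma nonseparableU A B x y : x != y -> [set x; y] \subset A :&: B ->
  nonseparable A -> nonseparable B -> nonseparable (A :|: B).
Proof.
move=> neq_xy; rewrite subUset !sub1set => /andP[/setIP[xA xB] /setIP[yA yB]].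
have del A' v : nonseparable A' -> connected_on (@adj G) (A' :\ v).
  case/andP=> cA' /forall_inP dA'; case vA': (v \in A'); first exact: dA'.
  by rewrite (setDidPl _) // disjoint_sym disjoints1 vA'.
move=> nA nB; apply/andP; split.
  by case/andP: nA nB => cA _ /andP[cB _]; apply: (connected_onU xA).
apply/forall_inP=> v _; rewrite setDUl.
have [neq_xv | eq_xv] := boolP (x != v).
  by apply: (@connected_onU _ _ x); rewrite ?del // !inE neq_xv.
apply: (@connected_onU _ _ y); rewrite ?del // !inE ?yA ?yB andbT.
  by rewrite eq_sym -(eqP (negbNE eq_xv)).
by rewrite eq_sym -(eqP (negbNE eq_xv)).
Qed.

Lemma cover_cycle_edges s : cover (cycle_edges s) = [set x in s].
Proof.
apply/setP=> x; rewrite inE; apply/bigcupP/idP => [[_ /imsetP[y ys ->]] | xs].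
  by case/set2P=> ->; rewrite ?mem_next.
by exists [set x; next s x]; rewrite ?set21 //; apply/imsetP; exists x.
Qed.

Lemma nonseparable_cycle C : C \in cycles G -> nonseparable (cover C).
Proof.
case/cyclesP=> s [lt2 us ->]; rewrite cover_cycle_edges; apply/andP; split.
  case: s us {lt2} => [|x p] /andP[xp _].
    by apply/connected_onP=> x; rewrite inE.
  by apply: connected_on_path; move: xp; rewrite /= rcons_path => /andP[].
apply/forall_inP=> v; rewrite inE => vs.
have [[|x p] [/andP[vp uniq_p] sp _ eqs]] := ucycle_rebase us vs.
  by rewrite -sp in lt2.
have -> : [set y in s] :\ v = [set y in x :: p].
  apply/setP=> y; rewrite !inE eqs inE; case: eqVneq => [-> | //].
  by case/andP: uniq_p; rewrite inE => /negPf->.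
by apply: connected_on_path; move: vp; rewrite /= rcons_path => /and3P[].
Qed.

(** At a vertex v of C where d is maximal, each of the two cycle edges would
    have to be the edge from v to its parent. This shows that neither a rooted
    tree nor a path contains a cycle. *)
Lemma cycle_not_descending (d : G -> nat) (par : G -> G) C : C \in cycles G ->
  exists2 f, f \in C & forall z, d (par z) < d z -> f != [set z; par z].
Proof.
case/cyclesP=> s [lt2 us ->].
case: s lt2 us => // x0 p0; set s := x0 :: p0 => lt2 us.
have [v vs max_v] : exists2 v, v \in s & {in s, forall y, d y <= d v}.
  have x0s : x0 \in s by rewrite mem_head.
  case: (arg_maxnP (P := mem s) d x0s) => v vs max_v.
  by exists v => // y ys; apply: max_v.
have [[|y p] [vp sp <- eqs]] := ucycle_rebase us vs; first by rewrite -sp in lt2.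
have lt1 : 0 < size p by rewrite -sp in lt2.
have /andP[_ uniq_vp] := vp.
have ys : y \in s by rewrite eqs inE mem_head orbT.
have ls : last y p \in s by rewrite eqs inE mem_last orbT.
have e1 : [set v; y] \in cycle_edges [:: v, y & p].
  by apply/(cycle_edgesP _ uniq_vp); exists 0.
have e2 : [set last y p; v] \in cycle_edges [:: v, y & p].
  by apply/(cycle_edgesP _ uniq_vp); exists (size p).+1 => //;
    rewrite -(step_edge_last v (y :: p)).
have bad u f : u \in s -> f = [set v; u] -> u != par v ->
  forall z, d (par z) < d z -> f != [set z; par z].
  move=> us' -> neq z ltz; apply/eqP=> /set2_eq[] [ev eu].
    by rewrite eu -ev eqxx in neq.
  by rewrite -ev -eu ltnNge max_v in ltz.
have [eqy | neqy] := eqVneq y (par v); last by exists [set v; y]; last exact: bad ys _ neqy.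
exists [set last y p; v] => //; apply: bad ls _ _; first by rewrite setUC.
rewrite -eqy; case: p lt1 uniq_vp {vp sp eqs e1 e2} => // a p _.
by case/and3P=> _ + _ /=; apply: contraNneq => <-; rewrite mem_last.
Qed.

(** If an edge e of C2 were missing from C1, then C1 would lie on the path that is
    left of C2 without e, directed from each vertex to its predecessor. *)
Lemma cycles_sub_eq C1 C2 :
  C1 \in cycles G -> C2 \in cycles G -> C1 \subset C2 -> C1 = C2.
Proof.
move=> C1c C2c sC; apply/eqP; rewrite eqEsubset sC /=; apply/subsetP=> e eC2.
have [x [p [/andP[_ us] lt1 defC2 def_e]]] := cycle_edge_based C2c eC2.
apply: contraT => eC1; set s := x :: p in us defC2.
have [f fC1 bad] := cycle_not_descending (fun z => index z s)
  (fun z => nth x s (index z s).-1) C1c.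
have /(cycle_edgesP _ us)[i lei def_f] : f \in cycle_edges s.
  by rewrite -defC2 (subsetP sC).
have {lei} lti : i < size p.
  rewrite ltn_neqAle lei andbT; apply: contraNneq eC1 => ei.
  by rewrite def_e -step_edge_last -ei -def_f.
have := bad (nth x s i.+1); rewrite !index_uniq //=; last exact: ltnW.
by rewrite def_f setUC eqxx => /(_ (ltnSn i)).
Qed.

(** The union of two cycles with a common edge is nonseparable, so it lies in one
    block, which is too large to be a cut edge. The block is therefore a cycle
    whose edges include those of both given cycles, and it equals each. *)
Lemma cactus_cycles_edge_disjoint C1 C2 f : cactus G ->
  C1 \in cycles G -> C2 \in cycles G -> f \in C1 -> f \in C2 -> C1 = C2.
Proof.
case=> _ blockG C1c C2c fC1 fC2.
have fsub C : f \in C -> f \subset cover C by move=> fC; apply: bigcup_sup.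
have /edgesP[x [y [xy def_f]]] := subsetP (cycles_sub_edges C1c) _ fC1.
have [|B maxB sB] := @maxset_exists _ (@nonseparable G) (cover C1 :|: cover C2).
  apply: (nonseparableU (adj_neq xy)).
  - by rewrite -def_f subsetI !fsub.
  - exact: nonseparable_cycle.
  exact: nonseparable_cycle.
have sCB C : C \in cycles G -> cover C \subset B -> C \subset induced_edges B.
  move=> Cc sC; apply/subsetP=> g gC; rewrite inE (subsetP (cycles_sub_edges Cc)) //=.
  by apply: subset_trans sC; apply: bigcup_sup.
move: sB; rewrite subUset => /andP[s1 s2].
case: (blockG B maxB) => [/andP[/edgesP[a [b [_ defB]]] _] | /andP[_ Bc]].
  have [s [lt2 /andP[_ us] defC1]] := cyclesP _ C1c.
  have := subset_leq_card s1; rewrite {s1}defC1 cover_cycle_edges cardsE.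
  rewrite (card_uniqP us) defB => le_s; have := leq_trans lt2 le_s.
  by rewrite cards2; case: (a != b).
by rewrite (cycles_sub_eq C1c Bc) ?sCB // (cycles_sub_eq C2c Bc) ?sCB.
Qed.
End Nonseparable.

(** * Removing the edges of a cycle *)

Definition without (G : sgraph) (D : {set {set G}}) (u v : G) : bool :=
  adj u v && ([set u; v] \notin D).
Arguments without G D u v /.

Definition edge_disjoint_cycles (G : sgraph) : Prop :=
  forall C1 C2 f, C1 \in cycles G -> C2 \in cycles G ->
    f \in C1 -> f \in C2 -> C1 = C2.

Section Separation.
Variable G : sgraph.
Implicit Types (u v w x y : G) (p s : seq G) (f g : {set G}) (A B : {set G}).
Implicit Types (C D : {set {set G}}).

Lemma without_sym D : connect_sym (without D).
Proof. by apply: sym_connect_sym => x y /=; rewrite adj_sym setUC. Qed.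

Lemma without_sub_adj D : subrel (without D) (@adj G).
Proof. by move=> x y /andP[]. Qed.

Lemma cycle_through u p : path (@adj G) u p -> uniq (u :: p) -> 1 < size p ->
  adj (last u p) u -> exists2 C, C \in cycles G &
    [set last u p; u] \in C /\ [set u; nth u p 0] \in C.
Proof.
move=> up us lt1 lu; exists (cycle_edges (u :: p)).
  apply/cyclesP; exists (u :: p); split=> //.
  by apply/andP; rewrite /= rcons_path up lu.
split; apply/(cycle_edgesP _ us); last by exists 0.
by exists (size p) => //; rewrite step_edge_last.
Qed.

(** A walk around the edge would close up to a cycle through it. *)
Lemma bridge_separates u v : adj u v ->
  (forall C, C \in cycles G -> [set u; v] \notin C) ->
  ~~ connect (without [set [set u; v]]) u v.
Proof.
move=> uv nC; apply/negP=> /connectP[p0 up0 ev].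
case/shortenP: up0 ev => p up us _ ev.
have /cycle_through : path (@adj G) u p by exact: sub_path (@without_sub_adj _) _ _ up.
case=> // [|/=|C /nC]; last by rewrite -ev setUC => /negPf-> [].
  case: p up us ev => [_ _ ev | x [|//] /andP[/andP[_ ux] _] _ /= ev].
    by rewrite ev adj_irrefl in uv.
  by rewrite ev !inE eqxx in ux.
by rewrite -ev adj_sym.
Qed.

Hypothesis ed : edge_disjoint_cycles G.

(** An ear of C, together with one of the two arcs of C between its ends, is a
    cycle that shares the edges of that arc with C but contains the first edge
    of the ear, which is not in C. The bound n serves for the induction: a path
    that meets C in between contains a shorter one. *)
Lemma no_ear_on_cycle C n x p : size p <= n -> C \in cycles G ->
  x \in cover C -> last x p \in cover C -> last x p != x ->
  path (without C) x p -> uniq (x :: p) -> False.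
Proof.
move=> + Cc; elim: n x p => [|n IHn] x p.
  by case: p => //= _ _ _; rewrite eqxx.
case/lastP: p => [|p y]; rewrite ?last_rcons ?size_rcons ?eqxx // ltnS.
move=> le_pn xC yC neq_yx xp us.
have [/hasP[z zp zC] | /hasPn pC] := boolP (has (mem (cover C)) p).
  (* The part of the path up to z is again an ear. *)
  case/splitPr: zp le_pn xp us => p1 p2 le_pn.
  rewrite -cat_rcons rcons_cat cat_path -cat_cons cat_uniq => /andP[xz _] /andP[us _].
  apply: (IHn _ _ _ xC _ _ xz us); rewrite ?last_rcons //.
    by move: le_pn; rewrite size_cat size_rcons /=; lia.
  by move: us; rewrite /= mem_rcons inE negb_or eq_sym => /andP[/andP[]].
have [s [lt2 us_s defC]] := cyclesP _ Cc.
have mem_s z : (z \in cover C) = (z \in s) by rewrite defC cover_cycle_edges inE.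
have [q [uxq _ eqC eqs]] := ucycle_rebase us_s (etrans (esym (mem_s x)) xC).
have yq : y \in q.
  by move: yC; rewrite mem_s eqs inE (negPf neq_yx).
case/splitPr: yq uxq eqC eqs => q1 q2 uxq eqC eqs; have /andP[cxq us_q] := uxq.
(* The arc y, q2, x is kept; its closing edge is common to both cycles. *)
have lastC : [set last y q2; x] \in C.
  rewrite defC -eqC; apply/(cycle_edgesP _ us_q).
  exists (size (q1 ++ y :: q2)) => //.
  by rewrite step_edge_last last_cat.
have q2C z : z \in q2 -> z \in cover C.
  by move=> zq; rewrite mem_s eqs inE mem_cat inE zq !orbT.
have /cycle_through[] : path (@adj G) x (rcons p y ++ q2).
- rewrite cat_path (sub_path (@without_sub_adj C) xp) last_rcons /=.
  by move: cxq; rewrite /= rcons_path cat_path /= => /andP[/and3P[]].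
- rewrite -cat_cons cat_uniq us /=.
  move: us_q; rewrite -cat_cons cat_uniq => /and3P[_ /hasPn nq /andP[yq2 uq2]].
  rewrite [uniq q2]uq2 andbT; apply/hasPn=> z zq2; rewrite -rcons_cons mem_rcons !inE.
  rewrite negb_or; apply/andP; split; first by apply: contraNneq yq2 => <-.
  rewrite negb_or (contraL (pC z) (q2C z zq2)) andbT.
  by have := nq z; rewrite !inE zq2 orbT negb_or => /(_ isT)/andP[].
- rewrite size_cat size_rcons addSn ltnS addn_gt0 !lt0n !size_eq0.
  rewrite -negb_and; apply/andP=> -[/eqP p0 /eqP q20].
  move: xp lastC; rewrite p0 q20 /= andbT setUC.
  by case/andP=> _ /negPf->.
- rewrite last_cat last_rcons; move: cxq.
  by rewrite /= rcons_path last_cat => /andP[].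
move=> C' C'c; rewrite last_cat last_rcons => -[/(ed Cc C'c lastC) <-].
by case: p xp {us le_pn pC} => [|z p] /= /andP[/andP[_ /negPf->]].
Qed.

Lemma cycle_separates C x y : C \in cycles G -> x \in cover C -> y \in cover C ->
  connect (without C) x y -> x = y.
Proof.
move=> Cc xC yC /connectP[p0 xp0 ey]; move: yC; rewrite {y}ey.
case/shortenP: xp0 => p xp us _ yC.
apply/eqP; rewrite eq_sym; apply: contraT => neq.
by case: (no_ear_on_cycle (leqnn _) Cc xC yC neq xp us).
Qed.

Hypothesis conn : forall x y, connect (@adj G) x y.

(** Along a walk from w to C, the first vertex on C is reached without using an
    edge of C. *)
Lemma cycle_gate C w : C \in cycles G -> exists x p,
  [/\ ucycle (@adj G) (x :: p), 1 < size p, C = cycle_edges (x :: p)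
    & connect (without C) w x].
Proof.
move=> Cc; have [s [lt2 us defC]] := cyclesP _ Cc.
suff [x xs wx] : exists2 x, x \in s & connect (without C) w x.
  have [p [uxp sp eqC _]] := ucycle_rebase us xs.
  by exists x, p; rewrite defC eqC; split=> //; rewrite -?defC // -ltnS sp.
case: s lt2 us defC => // x0 p0; set s := x0 :: p0 => _ _ defC.
have /connectP[p wp ex0] := conn w x0.
have: last w p \in s by rewrite -ex0 mem_head.
elim: p w wp {ex0} => [|z p IHp] w /=; first by exists w.
case/andP=> wz /IHp{}IHp /IHp[x xs zx].
have [wzC | wzC] := boolP ([set w; z] \in C); last first.
  by exists x => //; apply: connect_trans zx; rewrite connect1 //= wz.
exists w => //; suff: w \in cover C by rewrite defC cover_cycle_edges inE.
by apply/bigcupP; exists [set w; z]; rewrite ?set21.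
Qed.

(** A retraction onto C: c v is the position on C of the only vertex of C that is
    connected to v without the edges of C. *)
Lemma cycle_coloring x p : cycle_edges (x :: p) \in cycles G ->
  uniq (x :: p) -> exists c : G -> nat,
  [/\ forall i, i <= size p -> c (nth x (x :: p) i) = i,
      forall v, c v <= size p
    & forall u v, connect (without (cycle_edges (x :: p))) u v -> c u = c v].
Proof.
set s := x :: p => Cc us; set C := cycle_edges s in Cc *.
have mem_s z : (z \in cover C) = (z \in s) by rewrite cover_cycle_edges inE.
have gate v : has (connect (without C) v) s.
  have [y [q [_ _ eqC vy]]] := cycle_gate v Cc; apply/hasP; exists y => //.
  by rewrite -mem_s eqC cover_cycle_edges inE mem_head.
exists (fun v => find (connect (without C) v) s); split=> [i lei | v | u v uv].
- have := gate (nth x s i); rewrite has_find => ltf; have := ltf.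
  rewrite -has_find => /(nth_find x); set j := find _ _ in ltf * => ij.
  have := cycle_separates Cc _ _ ij; rewrite !mem_s !mem_nth //.
  by move=> /(_ isT isT)/eqP; rewrite nth_uniq // => /eqP.
- by rewrite -ltnS -[(size p).+1]/(size s) -has_find.
by apply: eq_find => z; rewrite /= (same_connect (@without_sym _) uv).
Qed.

(** The upper bound walks along either arc. For the lower bound, the distance
    from w on the component of x, continued by dist w x + min(t, L - t) on the
    component of the vertex at position t, is 1-Lipschitz. *)
Lemma dist_cycle w x p i : ucycle (@adj G) (x :: p) -> 1 < size p ->
  connect (without (cycle_edges (x :: p))) w x -> i <= (size p).+1 ->
  dist w (nth x (x :: p) i) = dist w x + minn i ((size p).+1 - i).
Proof.
move=> ux lt1 wx; set s := x :: p; set L := (size p).+1.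
have [cyc us] := andP ux.
have Cc : cycle_edges s \in cycles G by apply/cyclesP; exists s.
have [c [c_nth c_le c_conn]] := cycle_coloring Cc us.
have stepd j : j < L -> adj (nth x s j) (nth x s j.+1).
  by move=> ltj; apply: step_edge_adj.
have cx : c x = 0 by exact: (c_nth 0).
have nthL : nth x s L = x by rewrite nth_default.
move=> lei; apply/eqP; rewrite eqn_leq; apply/andP; split.
  (* bwd starts from index L, where nth returns its default value x. *)
  have fwd j : j <= L -> dist w (nth x s j) <= dist w x + j.
    elim: j => [_|j IHj ltj]; first by rewrite addn0.
    have := IHj (ltnW ltj); have := dist_stepr conn w (stepd j ltj); lia.
  have bwd j : j <= L -> dist w (nth x s (L - j)) <= dist w x + j.
    elim: j => [_|j IHj ltj]; first by rewrite subn0 nthL addn0.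
    have := IHj (ltnW ltj); have := stepd (L - j.+1); rewrite subnSK //.
    rewrite adj_sym => /(_ (leq_subr _ _))/(dist_stepr conn w); lia.
  have := fwd i lei; have := bwd (L - i) (leq_subr _ _); rewrite subKn //.
  by rewrite /minn; case: ltnP; lia.
have [->|ltiL] := eqVneq i L; first by rewrite nthL subnn minn0 addn0.
have {lei ltiL} lti : i <= size p by rewrite -ltnS ltn_neqAle ltiL.
pose F v := if c v == 0 then dist w v else dist w x + minn (c v) (L - c v).
have lipF u v : adj u v -> F v <= F u + 1.
  move=> uv; have [uvC | uvC] := boolP ([set u; v] \in cycle_edges s); last first.
    have cuv : c u = c v by apply/c_conn/connect1; rewrite /= uv.
    by rewrite /F cuv; case: ifP => _; [exact: dist_stepr | lia].
  have Fs j : j <= L -> F (nth x s j) = dist w x + minn j (L - j).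
    rewrite leq_eqVlt => /predU1P[->|ltj].
      by rewrite nthL /F cx subnn minn0 addn0.
    rewrite /F c_nth //; case: eqP => // ->.
    by rewrite min0n addn0.
  have /(cycle_edgesP _ us)[j lej /set2_eq[][-> ->]] := uvC.
    by rewrite !Fs //; [lia | exact: leqW].
  by rewrite !Fs //; [lia | exact: leqW].
have := dist_lipschitz conn w (nth x s i) lipF.
rewrite {1 2}/F c_nth // (c_conn _ _ wx) cx eqxx dist_xx add0n.
by case: eqP => // ->; rewrite min0n addn0.
Qed.
End Separation.

(** * The number of edges of a cactus *)

Section EdgeCount.
Variable G : sgraph.
Implicit Types (u v w x y : G) (p s : seq G) (f g : {set G}) (A B : {set G}).
Implicit Types (C D T : {set {set G}}).
Hypothesis ed : edge_disjoint_cycles G.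
Hypothesis conn : forall x y, connect (@adj G) x y.

(** Two removed edges split C into two arcs. With f1 as closing edge and f2 at
    position j, an edge of C off f1 and f2 does not change whether c v <= j, and
    an edge outside C does not change c v. *)
Lemma two_cycle_edges_cut C f1 f2 : C \in cycles G ->
  f1 \in C -> f2 \in C -> f1 != f2 ->
  exists u v, ~~ connect (without [set f1; f2]) u v.
Proof.
move=> Cc f1C f2C neq.
have [x [p [/andP[_ us] lt1 defC def1]]] := cycle_edge_based Cc f1C.
have := f2C; rewrite defC => /(cycle_edgesP _ us)[j lej def2].
have {lej} ltj : j < size p.
  rewrite ltn_neqAle lej andbT; apply: contraNneq neq => ej.
  by rewrite def1 def2 ej step_edge_last.
have [|c [c_nth c_le c_conn]] := cycle_coloring ed conn _ us; first by rewrite -defC.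
exists x, (last x p); apply/negP.
have closed_c : closed (without [set f1; f2]) [pred v | c v <= j].
  move=> u v /andP[uv]; rewrite !inE negb_or => /andP[n1 n2].
  have [|uvC] := boolP ([set u; v] \in C); last first.
    by rewrite (c_conn u v) // connect1 //= uv -defC.
  rewrite defC => /(cycle_edgesP _ us)[i lei e_uv].
  have neq_ij : i != j by apply: contraNneq n2 => ij; rewrite e_uv def2 ij.
  have lti : i < size p.
    rewrite ltn_neqAle lei andbT; apply: contraNneq n1 => ei.
    by rewrite e_uv def1 ei step_edge_last.
  by case/set2_eq: e_uv => -[-> ->]; rewrite !c_nth //; lia.
move=> /(closed_connect closed_c); rewrite !inE.
rewrite (last_nth x) c_nth // (c_nth 0) // leq0n; lia.
Qed.

Section SpanningTree.
Variable r : G.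

Definition parent v :=
  odflt v [pick y | adj v y && (dist r v == (dist r y).+1)].
Definition bfs_tree := [set [set v; parent v] | v in [set~ r]].
Local Notation T := bfs_tree.

Lemma parentP v : v != r -> adj v (parent v) /\ dist r v = (dist r (parent v)).+1.
Proof.
move=> neq; rewrite /parent; case: pickP => [y /andP[vy /eqP dv] | none] //.
have [y vy dv] := dist_first conn neq.
by have := none y; rewrite vy dist_sym // dv dist_sym // eqxx.
Qed.

Lemma tree_sub_edges : T \subset edges G.
Proof.
apply/subsetP=> _ /imsetP[v vr ->]; rewrite mem_edges.
by rewrite !inE in vr; case: (parentP vr).
Qed.

Lemma card_tree : #|T| = #|G|.-1.
Proof.
rewrite card_in_imset ?cardsC1 // => u v; rewrite !inE => ur vr.
have [_ du] := parentP ur; have [_ dv] := parentP vr.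
case/set2_eq=> -[// eu ev]; move: du dv; rewrite ev -eu; lia.
Qed.

(** Removing edges outside the tree does not disconnect the graph: descend from v
    to its parent. *)
Lemma tree_spans D v : [disjoint D & T] -> connect (without D) r v.
Proof.
move=> disj; have [n] := ubnP (dist r v); elim: n v => // n IHn v.
have [-> //|vr] := eqVneq v r.
have [v_par dv] := parentP vr; rewrite dv ltnS => /IHn r_par.
apply: connect_trans r_par _; rewrite without_sym connect1 //= v_par /=.
rewrite (disjointFl disj) //.
by apply/imsetP; exists v; rewrite ?inE.
Qed.

Lemma cycle_off_tree C : C \in cycles G -> exists2 f, f \in C & f \notin T.
Proof.
move=> Cc; have [f fC desc] := cycle_not_descending (dist r) parent Cc.
exists f => //; apply/negP=> /imsetP[v]; rewrite !inE => vr ef.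
have [_ dv] := parentP vr.
by have := desc v; rewrite dv ef eqxx => /(_ (leqnn _)).
Qed.

(** Each edge off the tree lies in a cycle, as the tree still connects its ends.
    This sets up a bijection with the cycles: a cycle cannot lie in the tree, and
    two of its edges cannot both be off the tree, since removing them disconnects
    the graph. *)
Lemma card_edges_off_tree : #|edges G :\: T| = #|cycles G|.
Proof.
pose phi f := odflt set0 [pick C in cycles G | f \in C].
have phiP f : f \in edges G :\: T -> phi f \in cycles G /\ f \in phi f.
  case/setDP=> fE fT; rewrite /phi; case: pickP => [C /andP[] //| none].
  have [u [v [uv def_f]]] := edgesP _ fE.
  have /negP[] : ~~ connect (without [set [set u; v]]) u v.
    by apply: bridge_separates => // C Cc; have := none C; rewrite Cc -def_f => /negbT.
  have rT w : connect (without [set [set u; v]]) r w.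
    by apply: tree_spans; rewrite disjoints1 -def_f.
  by apply: connect_trans (rT v); rewrite without_sym.
suff <- : phi @: (edges G :\: T) = cycles G.
  rewrite card_in_imset // => f1 f2 f1T f2T ephi.
  have [[C1 fC1] [_ fC2]] := (phiP _ f1T, phiP _ f2T).
  apply/eqP; apply: contraT => neq; rewrite -ephi in fC2.
  have [u [v]] := two_cycle_edges_cut C1 fC1 fC2 neq.
  have rT w : connect (without [set f1; f2]) r w.
    apply: tree_spans; case/setDP: f1T => _ n1; case/setDP: f2T => _ n2.
    rewrite disjoints_subset; apply/subsetP=> f; rewrite !inE.
    by case/orP=> /eqP->.
  by move/negP; case; apply: connect_trans (rT v); rewrite without_sym.
apply/setP=> C; apply/imsetP/idP => [[f /phiP[? _] ->] // | Cc].
have [f fC fT] := cycle_off_tree Cc.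
have fET : f \in edges G :\: T.
  by apply/setDP; split=> //; apply: subsetP fC; apply: cycles_sub_edges.
by exists f => //; have [fc ff] := phiP f fET; apply: ed ff.
Qed.
End SpanningTree.

Lemma card_edges_cactus (r : G) : (#|edges G|).+1 = #|G| + #|cycles G|.
Proof.
rewrite -(cardsID (bfs_tree r)).
rewrite card_edges_off_tree (setIidPr (tree_sub_edges r)) card_tree.
by rewrite -addSn prednK //; apply/card_gt0P; exists r.
Qed.
End EdgeCount.

(** * Edges of a cycle with equidistant ends *)

Section Level.
Variable G : sgraph.
Implicit Types (u v w x y : G) (p s : seq G) (f g : {set G}) (A B : {set G}).
Implicit Types (C D T : {set {set G}}).

(** With F the distance to a vertex or to an edge, this says that the edge f has
    equidistant ends, without choosing an order on them. *)
Definition level (F : G -> nat) f : bool :=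
  [forall u in f, forall v in f, F u == F v].

Lemma level_set2 F u v : level F [set u; v] = (F u == F v).
Proof.
apply/forall_inP/eqP => [lev | Fuv x xf].
  by apply/eqP; have /forall_inP-> := lev u (set21 u v); rewrite ?set22.
by apply/forall_inP=> y; move: xf; do 2!case/set2P=> ->; rewrite ?Fuv.
Qed.

Lemma card_ord_cond n (P : pred nat) j :
  (forall i, i < n -> P i = (i == j)) -> #|[set i : 'I_n | P i]| = (j < n).
Proof.
move=> PE; case: (ltnP j n) => [ltj | lej].
  rewrite (_ : [set i | _] = [set Ordinal ltj]) ?cards1 //.
  by apply/setP=> i; rewrite !inE PE.
apply: eq_card0 => i; rewrite inE PE //; apply/negbTE.
by rewrite neq_ltn (leq_trans (ltn_ord i)).
Qed.

Hypothesis ed : edge_disjoint_cycles G.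
Hypothesis conn : forall x y, connect (@adj G) x y.

(** With L = size p + 1, min(i, L - i) = min(i + 1, L - i - 1) amounts to
    2 i + 1 = L. *)
Lemma card_level_tent x p (F : G -> nat) a :
  uniq (x :: p) -> 1 < size p ->
  (forall i, i <= (size p).+1 ->
    F (nth x (x :: p) i) = a + minn i ((size p).+1 - i)) ->
  #|[set f in cycle_edges (x :: p) | level F f]| = odd (size p).+1.
Proof.
move=> us lt1 FE; rewrite card_cycle_edges_pred //.
(* For even L the witness j = L is out of range, so nothing is counted. *)
pose j := if odd (size p).+1 then (size p)./2 else (size p).+1.
rewrite (@card_ord_cond _ (fun i => level F (step_edge x p i)) j).
  by rewrite /j; case: ifP; lia.
move=> i lti; rewrite /step_edge level_set2 !FE //; last exact: ltnW.
by apply/eqP/eqP; rewrite /j; case: ifP; lia.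
Qed.

Lemma card_vertex_level C w : C \in cycles G ->
  #|[set f in C | level (fun u => dist u w) f]| = odd #|C|.
Proof.
move=> Cc; have [x [p [ux lt1 -> wx]]] := cycle_gate conn w Cc.
have /andP[_ us] := ux.
rewrite (@card_level_tent _ _ _ (dist w x)) ?card_cycle_edges // => i lei.
by rewrite dist_sym // dist_cycle.
Qed.

(** The distances to x and to last x p are min(i, L - i) and min(i + 1, L - i - 1)
    for L = size p + 1; the latter comes from rotating last x p to the front. *)
Lemma edist_cycle_edge x p i : ucycle (@adj G) (x :: p) -> 1 < size p ->
  i <= (size p).+1 ->
  edist [set last x p; x] (nth x (x :: p) i) = minn i (size p - i).
Proof.
move=> ux lt1 lei; rewrite edist_set2 // (dist_cycle ed conn ux lt1 (connect0 _ x) lei).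
rewrite dist_xx add0n; move: lei; rewrite leq_eqVlt => /predU1P[-> | lti].
  by rewrite subnn !minn0 (eqP (_ : size p - (size p).+1 == 0)) ?minn0 // subn_eq0.
pose q := belast x p; have def_rotr : rotr 1 (x :: p) = last x p :: q.
  by rewrite lastI rotr1_rcons.
have uq : ucycle (@adj G) (last x p :: q).
  by rewrite -def_rotr; apply: ucycle_rot.
have nth_q : nth (last x p) (last x p :: q) i.+1 = nth x (x :: p) i.
  rewrite [x :: p]lastI nth_rcons size_belast /=.
  have := lti; rewrite ltnS leq_eqVlt => /predU1P[-> | ltip].
    by rewrite ltnn eqxx nth_default ?size_belast.
  by rewrite ltip; apply: set_nth_default; rewrite size_belast.
have := @dist_cycle _ ed conn (last x p) (last x p) q i.+1 uq.
rewrite size_belast dist_xx add0n nth_q => -> //; lia.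
Qed.

(** An edge outside C has both ends in the same component off C, so it behaves
    like a vertex. An edge of C, taken as closing edge, is equidistant from its
    own ends and, for even length, also from those of the opposite edge. *)
Lemma card_edge_level C g : C \in cycles G -> g \in edges G ->
  #|[set f in C | level (edist g) f]| =
  if odd #|C| then 1 else (g \in C).*2.
Proof.
move=> Cc gE; case: (boolP (g \in C)) => gC.
  have [x [p [ux lt1 -> ->]]] := cycle_edge_based Cc gC.
  have /andP[_ us] := ux; rewrite card_cycle_edges // card_cycle_edges_pred //.
  (* The index ord_max is g itself; 2 i + 1 = size p is the opposite edge. *)
  rewrite (cardsD1 ord_max) inE step_edge_last level_set2.
  have e_last := edist_cycle_edge ux lt1 (leqnSn (size p)).
  have e_head := edist_cycle_edge ux lt1 (leq0n _).
  rewrite -last_nth in e_last; rewrite /= in e_head.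
  rewrite e_last e_head subnn minn0 min0n eqxx add1n.
  pose j := if odd (size p) then (size p)./2 else (size p).+1.
  rewrite (_ : _ :\ _ = [set i : 'I_(size p).+1 |
    (i != size p :> nat) && level (edist [set last x p; x]) (step_edge x p i)]).
    rewrite (@card_ord_cond _ (fun i => (i != size p) &&
      level (edist [set last x p; x]) (step_edge x p i)) j).
      by rewrite /j /=; case: (odd (size p)) => /=; lia.
    move=> i lti; rewrite /step_edge level_set2 !edist_cycle_edge //; last exact: ltnW.
    by rewrite /j; case: ifP; lia.
  by apply/setP=> i; rewrite !inE.
have [a [b [ab def_g]]] := edgesP _ gE.
have [x [p [ux lt1 defC ax]]] := cycle_gate conn a Cc.
have /andP[_ us] := ux.
have bx : connect (without C) b x.
  apply: connect_trans ax; rewrite without_sym connect1 //= ab /=.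
  by rewrite -def_g gC.
rewrite defC in ax bx *.
rewrite (@card_level_tent _ _ _ (edist g x)) ?card_cycle_edges //.
move=> i lei; rewrite def_g !edist_set2 // !(dist_cycle ed conn ux lt1) //.
lia.
Qed.

End Level.

(** * Peripheral vertices *)

Section Peripheral.
Variable G : sgraph.
Implicit Types (u v w x y z : G) (p s : seq G) (f g : {set G}) (A B : {set G}).
Implicit Types (C D T : {set {set G}}).

Definition nbhd u := [set v | adj u v].

(** In a connected cactus with an edge these are the leaves and the vertices of
    degree 2 on a triangle, which makes them the possible non-central vertices
    of C0. *)
Definition peripheral u : bool :=
  (#|nbhd u| <= 2) && [forall y in nbhd u, forall z in nbhd u, (y != z) ==> adj y z].

Definition peripheral_edge f : bool := [exists u in f, peripheral u].

Lemma peripheral_edge_set2 u v :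
  peripheral_edge [set u; v] = peripheral u || peripheral v.
Proof.
apply/exists_inP/orP => [[w /set2P[]-> ->] | [] pw]; [by left | by right | |].
  by exists u; rewrite ?set21.
by exists v; rewrite ?set22.
Qed.

Lemma peripheral_adj u y z :
  peripheral u -> adj u y -> adj u z -> y != z -> adj y z.
Proof.
case/andP=> _ /forall_inP clique uy uz neq.
have := clique y; rewrite inE uy => /(_ isT)/forall_inP/(_ z).
by rewrite inE uz neq => /(_ isT).
Qed.

Lemma peripheralI u v x :
  adj v x -> (forall y, adj u y -> y = v \/ y = x) -> peripheral u.
Proof.
move=> vx Nu; have sN : nbhd u \subset [set v; x].
  by apply/subsetP=> y; rewrite !inE => /Nu[]->; rewrite eqxx ?orbT.
apply/andP; split.
  by apply: leq_trans (subset_leq_card sN) _; rewrite cards2; case: (v != x).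
apply/forall_inP=> y; rewrite inE => /Nu Ny; apply/forall_inP=> z.
rewrite inE => /Nu Nz; apply/implyP.
by case: Ny Nz => -> [] ->; rewrite ?eqxx // adj_sym.
Qed.

Lemma peripheral_leaf u v : (forall y, adj u y -> y = v) -> peripheral u.
Proof.
move=> Nu; apply/andP; split.
  apply: (@leq_trans #|[set v]|); last by rewrite cards1.
  by apply/subset_leq_card/subsetP=> y; rewrite !inE => /Nu->.
apply/forall_inP=> y; rewrite inE => /Nu->; apply/forall_inP=> z.
by rewrite inE => /Nu->; rewrite eqxx.
Qed.

Hypothesis conn : forall x y, connect (@adj G) x y.

Lemma nv_trichotomy u v :
  nv u v + nv v u + #|[set w | level (fun x => dist x w) [set u; v]]| = #|G|.
Proof.
have := card_trichotomy [set: G] (dist u) (dist v); rewrite cardsT => <-.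
rewrite /nv; congr (_ + _ + _); apply: eq_card => w; rewrite !inE //.
by rewrite level_set2.
Qed.

Lemma me_trichotomy u v :
  me u v + me v u + #|[set g in edges G | level (edist g) [set u; v]]| = #|edges G|.
Proof.
have := card_trichotomy (edges G) (fun g => edist g u) (fun g => edist g v).
move=> <-; rewrite /me; congr (_ + _ + _); apply: eq_card => w.
by rewrite !inE level_set2.
Qed.

Lemma nv_gt0 u v : adj u v -> 0 < nv u v.
Proof.
move=> uv; apply/card_gt0P; exists u.
by rewrite inE dist_xx lt0n dist_eq0 // eq_sym adj_neq.
Qed.

Lemma nv_gt1 u v y : adj u v -> adj u y -> y != v -> ~~ adj y v -> 1 < nv u v.
Proof.
move=> uv uy neq nyv; have yv := dist_gt1 conn neq nyv.
apply: (@leq_trans #|[set u; y]|); first by rewrite cards2 adj_neq.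
apply/subset_leq_card/subsetP=> w /set2P[]->; rewrite inE.
  by rewrite dist_xx lt0n dist_eq0 // eq_sym adj_neq.
by rewrite dist_eq1 // dist_sym // dist_sym // (leq_trans _ yv) // dist_sym.
Qed.

(** For a neighbour y of u other than v, the edge uy contains u but not v. *)
Lemma nbhd_me u v : adj u v -> #|nbhd u| <= (me u v).+1.
Proof.
move=> uv; rewrite (cardsD1 v) inE uv ltnS.
rewrite -(@card_in_imset _ _ (fun y => [set u; y])).
  apply/subset_leq_card/subsetP=> _ /imsetP[y + ->].
  rewrite in_setD1 in_set => /andP[yv uy]; rewrite in_set mem_edges uy /=.
  have nz : [set u; y] != set0 by apply: edge_neq0; rewrite mem_edges.
  have /eqP-> : edist [set u; y] u == 0 by rewrite edist_eq0 ?set21.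
  rewrite lt0n edist_eq0 //.
  by rewrite !inE negb_or ![v == _]eq_sym adj_neq.
move=> y z; rewrite !inE => /andP[_ uy] /andP[_ uz] /set2_eq[[]//|[-> //]].
Qed.

(** A shortest way from an edge g off u to u enters u from v or from a neighbour
    of v, so such a g is not closer to u than to v. *)
Lemma me_peripheral u v : adj u v -> peripheral u -> (me u v).+1 = #|nbhd u|.
Proof.
move=> uv pu; apply/eqP; rewrite eqn_leq nbhd_me // andbT.
rewrite (cardsD1 v (nbhd u)) inE uv ltnS.
apply: leq_trans (leq_imset_card (fun y => [set u; y]) _).
apply/subset_leq_card/subsetP=> g; rewrite in_set => /andP[gE ltg].
have nz := edge_neq0 gE; apply/imsetP; have [ug | ug] := boolP (u \in g).
  have [y uy eg] : exists2 y, adj u y & g = [set u; y].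
    have [a [b [ab eg]]] := edgesP _ gE; move: ug; rewrite eg.
    case/set2P=> ->; first by exists b.
    by exists a; rewrite 1?adj_sym // setUC.
  exists y => //; rewrite !inE uy andbT; apply: contraTneq ltg => eyv.
  suff -> : edist g v = 0 by [].
  by apply/eqP; rewrite edist_eq0 // eg eyv set22.
have [x ux dux] := edist_first conn nz ug; move: ltg; rewrite dux.
have [-> | neq] := eqVneq x v; first by rewrite ltnNge leqnSn.
by have := edist_step conn nz (peripheral_adj pu ux uv neq); lia.
Qed.

Lemma nv_peripheral u v : adj u v -> peripheral u -> nv u v = 1.
Proof.
move=> uv pu; apply/eqP; rewrite eqn_leq nv_gt0 // andbT.
apply: (@leq_trans #|[set u]|); last by rewrite cards1.
apply/subset_leq_card/subsetP=> w; rewrite !inE => ltw.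
apply: contraLR ltw; rewrite eq_sym => /(dist_first conn)[x ux dux].
rewrite -leqNgt dux; have [-> | neq] := eqVneq x v; first exact: leqnSn.
have := dist_stepl conn w (peripheral_adj pu ux uv neq); lia.
Qed.

Hypothesis ed : edge_disjoint_cycles G.

Lemma cycle_other_nbr C u v : C \in cycles G -> [set u; v] \in C ->
  exists2 y, adj u y & y != v.
Proof.
move=> Cc uvC; have [s [lt2 us defC]] := cyclesP _ Cc.
have us' : u \in s.
  suff: u \in cover C by rewrite defC cover_cycle_edges inE.
  by apply/bigcupP; exists [set u; v]; rewrite ?set21.
have [[|y p] [/andP[up uniq_p] sp _ _]] := ucycle_rebase us us'.
  by rewrite -sp in lt2.
have [eyv | neq] := eqVneq y v; last by exists y => //; case/andP: up.
exists (last y p).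
  by rewrite adj_sym; move: up; rewrite /= rcons_path => /and3P[].
case: p uniq_p sp {up} => [_ sp|z p]; first by rewrite -sp in lt2.
by case/and3P=> _ + _ _ /=; rewrite -eyv; apply: contraNneq => <-; rewrite mem_last.
Qed.

Lemma triangle_cycle u v y : adj u v -> adj v y -> adj u y ->
  exists C, [/\ C \in cycles G, [set u; v] \in C, #|C| = 3 & y \in cover C].
Proof.
move=> uv vy uy; exists (cycle_edges [:: u; v; y]).
have us : uniq [:: u; v; y] by rewrite /= !inE negb_or !adj_neq.
split.
- apply/cyclesP; exists [:: u; v; y]; split=> //; apply/andP; split=> //.
  by rewrite /= uv vy (adj_sym y u) uy.
- by apply/(cycle_edgesP _ us); exists 0.
- by rewrite card_cycle_edges.
by rewrite cover_cycle_edges !inE eqxx !orbT.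
Qed.

Lemma cycle3_third C u v : C \in cycles G -> #|C| = 3 -> [set u; v] \in C ->
  exists x, [/\ adj u x, adj v x & cover C = [set u; v; x]].
Proof.
move=> Cc C3 uvC; have [x [p [ux lt1 defC e_uv]]] := cycle_edge_based Cc uvC.
have [cx us] := andP ux.
have : size p = 2 by move: C3; rewrite defC card_cycle_edges // => -[].
case: p cx us {ux lt1} defC e_uv => [|a [|b []]] //= /and4P[xa ab bx _] _ defC.
have covC : cover C = [set x; a; b].
  by rewrite defC cover_cycle_edges; apply/setP=> z; rewrite !inE orbA.
case/set2_eq=> -[-> ->] _; exists a; rewrite covC; split=> //.
- by rewrite adj_sym.
- by apply/setP=> z; rewrite !inE; case: (z == x); case: (z == a); case: (z == b).
- by rewrite adj_sym.
by apply/setP=> z; rewrite !inE; case: (z == x); case: (z == a); case: (z == b).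
Qed.

(** The second neighbour of u on C is adjacent to v. This triangle shares the edge
    uv with C, hence is C. *)
Lemma peripheral_in_cycle C u v : C \in cycles G -> [set u; v] \in C ->
  peripheral u -> #|C| = 3 /\ me u v = 1.
Proof.
move=> Cc uvC pu; have [y uy neq] := cycle_other_nbr Cc uvC.
have uv : adj u v by rewrite -mem_edges (subsetP (cycles_sub_edges Cc)).
have vy := peripheral_adj pu uv uy _; rewrite eq_sym neq in vy.
have [C' [C'c uvC' C'3 _]] := triangle_cycle uv (vy isT) uy.
split; first by rewrite (ed Cc C'c uvC uvC').
apply: succn_inj; rewrite me_peripheral //; apply/eqP; rewrite eqn_leq.
have /andP[-> _] := pu.
apply: (@leq_trans #|[set y; v]|); first by rewrite cards2 neq.
by apply/subset_leq_card/subsetP=> w /set2P[]->; rewrite inE.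
Qed.

(** A second neighbour of u would be adjacent to v and put uv on a triangle. *)
Lemma peripheral_bridge u v : adj u v ->
  (forall C, C \in cycles G -> [set u; v] \notin C) ->
  peripheral u -> me u v = 0.
Proof.
move=> uv nC pu; apply/eqP; rewrite -eqSS me_peripheral //.
rewrite (cardsD1 v) inE uv eqSS cards_eq0 -subset0; apply/subsetP=> y.
rewrite !inE => /andP[neq uy].
have vy : adj v y by apply: (peripheral_adj pu) => //; rewrite eq_sym.
by have [C [/nC/negPf->]] := triangle_cycle uv vy uy.
Qed.

Lemma me0_leaf u v : adj u v -> me u v = 0 -> peripheral u.
Proof.
move=> uv me0; have := nbhd_me uv; rewrite me0 (cardsD1 v) inE uv ltnS leqn0.
rewrite cards_eq0 => /eqP N0; apply: (@peripheral_leaf _ v) => y uy.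
apply/eqP; apply: contraT => neq; have := in_set0 y.
by rewrite -N0 !inE neq uy.
Qed.

(** Let x be the third vertex of C. If u had a neighbour y other than v and x, the
    edges ux and uy would give me u v > 1. Moreover y would not be adjacent to v,
    as the triangle uvy would share an edge with C; so y would be closer to u and
    give nv u v > 1. *)
Lemma cycle3_peripheral C u v : C \in cycles G -> #|C| = 3 -> [set u; v] \in C ->
  me u v = 1 \/ nv u v = 1 -> peripheral u.
Proof.
move=> Cc C3 uvC me_nv.
have uv : adj u v by rewrite -mem_edges (subsetP (cycles_sub_edges Cc)).
have [x [ux vx covC]] := cycle3_third Cc C3 uvC.
apply: (peripheralI vx) => y uy; have [->|neq] := eqVneq y v; [by left | right].
case: me_nv => [me1 | nv1].
  apply/eqP; apply: contraT => neq_yx; have := nbhd_me uv; rewrite me1.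
  rewrite (cardsD1 v) inE uv ltnS (cardsD1 y) !inE neq uy /= add1n ltnS leqn0.
  rewrite cards_eq0 => /eqP/setP/(_ x); rewrite !inE ux eq_sym neq_yx.
  by rewrite eq_sym adj_neq.
have vy : adj v y.
  apply: contraT; rewrite adj_sym => /(nv_gt1 uv uy neq).
  by rewrite nv1.
have [C' [C'c uvC' _]] := triangle_cycle uv vy uy.
rewrite -(ed Cc C'c uvC uvC') covC !inE (negPf neq) orbF.
by rewrite eq_sym (negPf (adj_neq uy)) => /eqP.
Qed.

End Peripheral.

(** * Sums over the edges as unordered pairs *)

Section EdgeSums.
Variable G : sgraph.
Implicit Types (u v w x y z : G) (f g : {set G}) (C : {set {set G}}).

(** For an edge f the sum has a single term, from the orientation of f that the
    enumeration of the vertices selects. *)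
Definition edge_weight (F : G -> G -> nat) f : nat :=
  \sum_(p : G * G | adj p.1 p.2 && (enum_rank p.1 < enum_rank p.2)
                    && ([set p.1; p.2] == f)) F p.1 p.2.

Lemma sum_edge_weight F :
  \sum_(u : G) \sum_(v : G | adj u v && (enum_rank u < enum_rank v)) F u v =
  \sum_(f in edges G) edge_weight F f.
Proof.
rewrite pair_big_dep /=.
rewrite (partition_big (fun p : G * G => [set p.1; p.2]) (mem (edges G))) //=.
by case=> u v /= /andP[uv _]; rewrite mem_edges.
Qed.

Lemma edge_weight_set2 F u v : (forall x y, F x y = F y x) -> adj u v ->
  edge_weight F [set u; v] = F u v.
Proof.
move=> symF; wlog lt_uv : u v / enum_rank u < enum_rank v => [th|] uv.
  case: (ltngtP (enum_rank u) (enum_rank v)) => [lt_uv | lt_vu | /val_inj/enum_rank_inj e].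
  - exact: th.
  - by rewrite setUC symF th // adj_sym.
  by rewrite e adj_irrefl in uv.
rewrite /edge_weight (big_pred1 (u, v)) // => -[x y] /=; rewrite xpair_eqE.
apply/andP/andP => [[/andP[xy lt_xy] /eqP/set2_eq[]] | [/eqP-> /eqP->]].
- by case=> -> ->.
- by case=> ex ey; move: lt_xy; rewrite ex ey ltnNge ltnW.
by rewrite uv lt_uv.
Qed.
End EdgeSums.

(** * Bridges *)

Section Bridges.
Variable G : sgraph.
Implicit Types (u v w x y z : G) (f g : {set G}) (C : {set {set G}}).
Hypothesis conn : forall x y, connect (@adj G) x y.

Lemma bridge_sides u v w : adj u v ->
  connect (without [set [set u; v]]) w u \/ connect (without [set [set u; v]]) w v.
Proof.
move=> uv; apply/orP; set e := without _; pose side x := connect e x u || connect e x v.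
have closed_side : closed (@adj G) [pred x | side x].
  move=> x y xy; rewrite !inE /side.
  have [exy | exy] := boolP (e x y).
    by rewrite !(same_connect (@without_sym _ _) (connect1 exy)).
  move: exy; rewrite /e /= xy !inE negbK => /eqP/set2_eq.
  by case=> -[-> ->]; rewrite !connect0 ?orbT.
have := closed_connect closed_side (conn u w).
by rewrite !inE /side connect0 => <-.
Qed.

(** The lower bound is the Lipschitz argument for the function that is dist w on
    the side of u and constant on the side of v. *)
Lemma bridge_dist u v w : adj u v ->
  ~~ connect (without [set [set u; v]]) u v ->
  connect (without [set [set u; v]]) w u -> dist w v = (dist w u).+1.
Proof.
move=> uv nuv wu; set e := without _ in nuv wu.
pose F x := if connect e x u then dist w x else (dist w u).+1.
have lipF x y : adj x y -> F y <= F x + 1.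
  move=> xy; have [exy | exy] := boolP (e x y).
    rewrite /F (same_connect (@without_sym _ _) (connect1 exy)).
    by case: ifP => _; [exact: dist_stepr | lia].
  move: exy; rewrite /e /= xy !inE negbK => /eqP/set2_eq.
  case=> -[-> ->]; rewrite /F connect0 [connect _ v u]without_sym (negPf nuv); lia.
have := dist_lipschitz conn w v lipF.
rewrite /F wu [connect _ v u]without_sym (negPf nuv) dist_xx add0n => ge.
by apply/eqP; rewrite eqn_leq ge -addn1 dist_stepr.
Qed.

(** Any edge but the bridge lies on one of its two sides and is closer to that
    end. *)
Lemma bridge_edge_level u v : adj u v ->
  ~~ connect (without [set [set u; v]]) u v ->
  #|[set g in edges G | level (edist g) [set u; v]]| = 1.
Proof.
move=> uv nuv; rewrite (_ : [set g in _ | _] = [set [set u; v]]) ?cards1 //.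
have closer (x y : G) g : adj x y -> ~~ connect (without [set [set x; y]]) x y ->
  g \in edges G -> g != [set x; y] ->
  (exists2 a, a \in g & connect (without [set [set x; y]]) a x) ->
  edist g x < edist g y.
  move=> xy nxy gE neq [a ag ax]; have [z zg ->] := edist_attained y (edge_neq0 gE).
  suff zx : connect (without [set [set x; y]]) z x.
    by rewrite (bridge_dist xy nxy zx) ltnS edist_leq.
  have [eza | neqza] := eqVneq z a; first by rewrite eza.
  apply: connect_trans ax; apply: connect1.
  have [b [c [bc eg]]] := edgesP _ gE; rewrite /= !inE.
  suff eza : [set z; a] = g by rewrite -mem_edges eza gE.
  rewrite eg in zg ag *; case/set2P: zg ag neqza => -> /set2P[] ->;
    by rewrite ?eqxx // setUC.
apply/setP=> g; rewrite in_set in_set1 level_set2; apply/andP/eqP => [[gE /eqP eqd] | ->].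
  apply/eqP; apply: contraT => neq.
  have [a ag] := set0Pn _ (edge_neq0 gE).
  have [au | av] := bridge_sides a uv.
    by have := closer u v g uv nuv gE neq (ex_intro2 _ _ a ag au); rewrite eqd ltnn.
  rewrite setUC in nuv av neq.
  have := closer v u g _ _ gE neq (ex_intro2 _ _ a ag av).
  by rewrite adj_sym uv without_sym nuv eqd ltnn => /(_ isT isT).
have nz : [set u; v] != set0 by apply: edge_neq0; rewrite mem_edges.
have /eqP-> : edist [set u; v] u == 0 by rewrite edist_eq0 ?set21.
have /eqP-> : edist [set u; v] v == 0 by rewrite edist_eq0 ?set22.
by rewrite mem_edges.
Qed.
End Bridges.

(** * Contributions of the blocks *)

Section Bounds.
Variable G : sgraph.
Implicit Types (u v w x y z : G) (f g : {set G}) (C : {set {set G}}).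
Hypothesis conn : forall x y, connect (@adj G) x y.
Hypothesis ed : edge_disjoint_cycles G.
Hypothesis hn : 5 <= #|G|.

Local Notation n := (#|G|).
Local Notation m := (#|edges G|).
Local Notation zv f := (#|[set w | level (fun x => dist x w) f]|).
Local Notation ze f := (#|[set g in edges G | level (edist g) f]|).

Lemma sum_vertex_level C : C \in cycles G ->
  \sum_(f in C) zv f = odd #|C| * n.
Proof.
move=> Cc; transitivity (\sum_(w in [set: G]) odd #|C|).
  rewrite (eq_bigr (fun f => #|[set w in [set: G] | level (fun x => dist x w) f]|)).
    rewrite sum_card_exchange; apply: eq_bigr => w _.
    by rewrite card_vertex_level.
  by move=> f _; apply: eq_card => w; rewrite !inE.
by rewrite sum_nat_const cardsT mulnC.
Qed.

Lemma sum_edge_level C : C \in cycles G ->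
  \sum_(f in C) ze f = if odd #|C| then m else #|C|.*2.
Proof.
move=> Cc; rewrite sum_card_exchange.
under eq_bigr => g gE do rewrite card_edge_level //.
case: odd; first by rewrite sum1_card.
rewrite -muln2 -sum1_card big_distrl /= [RHS]big_mkcond.
rewrite (bigID (mem C)) /= [X in _ + X]big1 ?addn0; last first.
  by move=> g /andP[_ /negPf->].
rewrite -big_mkcond; apply: congr_big => // g.
  by apply: andb_idl => /(subsetP (cycles_sub_edges Cc)).
by case/andP=> _ ->.
Qed.

Lemma cycle_edge_adj C u v : C \in cycles G -> [set u; v] \in C -> adj u v.
Proof. by move=> Cc; rewrite -mem_edges; apply/subsetP/cycles_sub_edges. Qed.

Lemma me_cycle_gt0 C u v : C \in cycles G -> [set u; v] \in C -> 0 < me u v.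
Proof.
move=> Cc uvC; have uv := cycle_edge_adj Cc uvC.
have [y uy neq] := cycle_other_nbr Cc uvC.
rewrite -ltnS; apply: leq_trans (nbhd_me conn uv).
apply: (@leq_trans #|[set y; v]|); first by rewrite cards2 neq.
by apply/subset_leq_card/subsetP=> w /set2P[]->; rewrite inE.
Qed.

Definition sz_e_term u v := me u v * me v u.
Definition sz_ev_term u v := nv u v * me v u + nv v u * me u v.

Lemma sz_e_termC u v : sz_e_term u v = sz_e_term v u.
Proof. exact: mulnC. Qed.
Lemma sz_ev_termC u v : sz_ev_term u v = sz_ev_term v u.
Proof. exact: addnC. Qed.

Local Notation E f := ((edge_weight sz_e_term f)%:Z)%R.
Local Notation V f := ((edge_weight sz_ev_term f)%:Z)%R.

Lemma bridge_sz_e f : f \in edges G -> (forall C, C \in cycles G -> f \notin C) ->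
  (0 <= E f ?= iff peripheral_edge f)%R.
Proof.
case/edgesP=> u [v [uv ->]] nC; rewrite edge_weight_set2 //; last exact: sz_e_termC.
rewrite peripheral_edge_set2; split; first by [].
have nC' C : C \in cycles G -> [set v; u] \notin C by rewrite setUC => /nC.
have vu : adj v u by rewrite adj_sym.
rewrite eq_sym; apply/eqP/orP => [[] /eqP | []].
- rewrite muln_eq0 => /orP[]/eqP me0; [left | right].
    exact: (me0_leaf conn uv).
  exact: (me0_leaf conn vu).
- by move=> pu; rewrite /sz_e_term (peripheral_bridge conn uv).
- by move=> pv; rewrite /sz_e_term (peripheral_bridge conn vu) // muln0.
Qed.

(** Here n_u, n_v >= 1 and m_u + m_v = m - 1, so n_u m_v + n_v m_u >= m - 1. If
    neither end is peripheral, then n_u, n_v >= 2 and m_u, m_v >= 1, which makes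
    the inequality strict. *)
Lemma bridge_sz_ev f : f \in edges G -> (forall C, C \in cycles G -> f \notin C) ->
  (0 <= V f - (m%:Z - 1) ?= iff peripheral_edge f)%R.
Proof.
case/edgesP=> u [v [uv ->]] nC; rewrite edge_weight_set2 //; last exact: sz_ev_termC.
rewrite peripheral_edge_set2.
have nC' C : C \in cycles G -> [set v; u] \notin C by rewrite setUC => /nC.
have vu : adj v u by rewrite adj_sym.
have := me_trichotomy u v.
rewrite (bridge_edge_level conn uv (bridge_separates uv nC)).
have := nv_gt0 conn uv; have := nv_gt0 conn vu; rewrite /sz_ev_term.
have [pu | npu] := boolP (peripheral u).
  rewrite (peripheral_bridge conn uv) // (nv_peripheral conn uv) //.
  by move=> *; split; lia.
have [pv | npv] := boolP (peripheral v).
  rewrite (peripheral_bridge conn vu) // (nv_peripheral conn vu) //.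
  by move=> *; split; lia.
have inner x y : adj x y -> (forall C, C \in cycles G -> [set x; y] \notin C) ->
    ~~ peripheral x -> 0 < me x y /\ 1 < nv x y.
  move=> xy nCxy npx; have me_gt0 : 0 < me x y.
    by rewrite lt0n; apply: contraNneq npx => /(me0_leaf conn xy).
  split=> //; have [z /andP[xz neq]] : exists z, adj x z && (z != y).
    apply/existsP; apply: contraR npx => /existsPn nz.
    by apply: (@peripheral_leaf _ _ y) => z xz; have := nz z; rewrite xz => /negPn/eqP.
  apply: (nv_gt1 conn xy xz neq); apply/negP=> zy.
  have yz : adj y z by rewrite adj_sym.
  by have [C [/nCxy/negPf->]] := triangle_cycle xy yz xz.
have [p0 nu] := inner u v uv nC npu; have [q0 nv'] := inner v u vu nC' npv.
move=> _ _ pq1.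
suff lt: (0 < (nv u v * me v u + nv v u * me u v)%N%:Z - (m%:Z - 1))%R.
  by split; [exact: ltW | rewrite lt_eqF].
nia.
Qed.

(** In a cycle with more than three edges no edge has a peripheral end, so the
    bound has to be strict there; L is the linear lower bound of H whose sum
    over C is known. *)
Lemma cycle_leif_by_length C (H L : {set G} -> int) (b : int) : C \in cycles G ->
  (forall f, f \in C -> L f <= H f)%R ->
  (#|C| = 3 -> forall f, f \in C -> (H f == L f) = peripheral_edge f) ->
  (#|C| = 3 -> (\sum_(f in C) L f)%R = b) ->
  ((3 < #|C|)%N -> (b < \sum_(f in C) L f)%R) ->
  (b <= \sum_(f in C) H f ?= iff [forall f in C, peripheral_edge f])%R.
Proof.
move=> Cc leLH eqLH sum3 sum4; have [C3 | neq3] := eqVneq #|C| 3.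
  rewrite -sum3 //; apply: leif_sum => f fC; split; first exact: leLH.
  by rewrite eq_sym eqLH.
have lt : (b < \sum_(f in C) H f)%R.
  apply: lt_le_trans (ler_sum _ leLH); apply: sum4.
  by rewrite ltn_neqAle eq_sym neq3 card_cycle_gt2.
split; [exact: ltW | rewrite lt_eqF //; apply/esym/negbTE].
have [f fC] : exists f, f \in C.
  by apply/set0Pn; rewrite -card_gt0 (leq_trans _ (card_cycle_gt2 Cc)).
apply/forall_inPn; exists f => //.
have /edgesP[u [v [_ ef]]] := subsetP (cycles_sub_edges Cc) _ fC.
rewrite ef peripheral_edge_set2 in fC *; apply/negP=> /orP[] p.
  by case: (peripheral_in_cycle conn ed Cc fC p) => C3; rewrite C3 in neq3.
rewrite setUC in fC.
by case: (peripheral_in_cycle conn ed Cc fC p) => C3; rewrite C3 in neq3.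
Qed.

Lemma card_vertices_leq_edges C : C \in cycles G -> n <= m.
Proof.
move=> Cc; have [r _] : exists r : G, r \in G by apply/card_gt0P; apply: leq_trans hn.
have := card_edges_cactus ed conn r.
have : 0 < #|cycles G| by apply/card_gt0P; exists C.
lia.
Qed.

(** Summing m_u m_v >= m_u + m_v - 1 over a cycle of length L gives
    (L - 1) m - L if L is odd and L (m - 3) if L is even. For L = 3 this is
    2 m - 3, and for L > 3 and m >= 5 it is larger. *)
Lemma cycle_sz_e C : C \in cycles G ->
  (2 * m%:Z - 3 <= \sum_(f in C) E f ?= iff [forall f in C, peripheral_edge f])%R.
Proof.
move=> Cc; have le_nm := card_vertices_leq_edges Cc.
have sumL : (\sum_(f in C) (m%:Z - 1 - (ze f)%:Z) =
             (m%:Z - 1) * #|C|%:Z - (if odd #|C| then m else #|C|.*2)%:Z)%R.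
  by rewrite sumrB sumr_const -mulr_natr natz sum_Posz sum_edge_level.
apply: (@cycle_leif_by_length _ _ (fun f => m%:Z - 1 - (ze f)%:Z)%R) => //.
- move=> f fC; have /edgesP[u [v [uv ef]]] := subsetP (cycles_sub_edges Cc) _ fC.
  rewrite ef in fC *; rewrite edge_weight_set2 //; last exact: sz_e_termC.
  have p0 := me_cycle_gt0 Cc fC; have q0 : 0 < me v u.
    by apply: (me_cycle_gt0 Cc); rewrite setUC.
  have := me_trichotomy u v; rewrite /sz_e_term; nia.
- move=> C3 f fC; have /edgesP[u [v [uv ef]]] := subsetP (cycles_sub_edges Cc) _ fC.
  rewrite ef in fC *; rewrite edge_weight_set2 //; last exact: sz_e_termC.
  rewrite peripheral_edge_set2.
  have vuC : [set v; u] \in C by rewrite setUC.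
  have p0 := me_cycle_gt0 Cc fC; have q0 := me_cycle_gt0 Cc vuC.
  have pu := cycle3_peripheral conn ed Cc C3 fC.
  have pv := cycle3_peripheral conn ed Cc C3 vuC.
  have up pu' := (peripheral_in_cycle conn ed Cc fC pu').2.
  have vp pv' := (peripheral_in_cycle conn ed Cc vuC pv').2.
  have tri := me_trichotomy u v; rewrite /sz_e_term.
  apply/eqP/orP => [eqE | [/up e | /vp e]].
  + have : (me u v == 1) || (me v u == 1).
      apply: contraT; rewrite negb_or => /andP[/eqP n1 /eqP n2]; nia.
    by case/orP=> /eqP e; [left; apply: pu | right; apply: pv]; left.
  + by rewrite e mul1n; lia.
  + by rewrite e muln1; lia.
- by move=> C3; rewrite sumL C3 /=; lia.
move=> lt3; rewrite sumL; case: ifP => [oddC | evenC].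
  have : 4 < #|C| by move: lt3; rewrite leq_eqVlt => /predU1P[e|//]; rewrite -e in oddC.
  nia.
nia.
Qed.

(** Summing n_u m_v + n_v m_u >= n_u + n_v + m_u + m_v - 2 and subtracting m - 1
    per edge gives L (n - 1) - n - m if L is odd and L (n - 3) if L is even. For
    L = 3 this is 2 n - m - 3, and for L > 3 and m >= n >= 5 it is larger. *)
Lemma cycle_sz_ev C : C \in cycles G ->
  (2 * n%:Z - m%:Z - 3 <= \sum_(f in C) (V f - (m%:Z - 1)) ?= iff
   [forall f in C, peripheral_edge f])%R.
Proof.
move=> Cc; have le_nm := card_vertices_leq_edges Cc.
pose L f := (n%:Z - 1 - (zv f)%:Z - (ze f)%:Z)%R.
have sumL : (\sum_(f in C) L f = (n%:Z - 1) * #|C|%:Z - (odd #|C| * n)%N%:Z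
   - (if odd #|C| then m else #|C|.*2)%:Z)%R.
  rewrite [LHS]sumrB [X in (X - _)%R]sumrB sumr_const -mulr_natr natz !sum_Posz.
  by rewrite sum_vertex_level // sum_edge_level.
apply: (@cycle_leif_by_length _ _ L) => //.
- move=> f fC; have /edgesP[u [v [uv ef]]] := subsetP (cycles_sub_edges Cc) _ fC.
  rewrite /L ef in fC *; rewrite edge_weight_set2 //; last exact: sz_ev_termC.
  have p0 := me_cycle_gt0 Cc fC; have q0 : 0 < me v u.
    by apply: (me_cycle_gt0 Cc); rewrite setUC.
  have := nv_gt0 conn uv; have : 0 < nv v u by apply: nv_gt0; rewrite // adj_sym.
  have := me_trichotomy u v; have := nv_trichotomy u v.
  rewrite /sz_ev_term; nia.
- move=> C3 f fC; have /edgesP[u [v [uv ef]]] := subsetP (cycles_sub_edges Cc) _ fC.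
  rewrite /L ef in fC *; rewrite edge_weight_set2 //; last exact: sz_ev_termC.
  rewrite peripheral_edge_set2.
  have vuC : [set v; u] \in C by rewrite setUC.
  have vu : adj v u by rewrite adj_sym.
  have p0 := me_cycle_gt0 Cc fC; have q0 := me_cycle_gt0 Cc vuC.
  have nu0 := nv_gt0 conn uv; have nv0 := nv_gt0 conn vu.
  have pu := cycle3_peripheral conn ed Cc C3 fC.
  have pv := cycle3_peripheral conn ed Cc C3 vuC.
  have up pu' := (peripheral_in_cycle conn ed Cc fC pu').2.
  have vp pv' := (peripheral_in_cycle conn ed Cc vuC pv').2.
  have un := nv_peripheral conn uv; have vn := nv_peripheral conn vu.
  have trim := me_trichotomy u v; have trin := nv_trichotomy u v.
  rewrite /sz_ev_term; apply/eqP/orP => [eqE | [pu' | pv']].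
  + have : (nv u v == 1) || (me v u == 1).
      apply: contraT; rewrite negb_or => /andP[/eqP n1 /eqP n2]; nia.
    by case/orP=> /eqP e; [left; apply: pu; right | right; apply: pv; left].
  + by rewrite (up pu') (un pu') mul1n muln1 in trim trin *; lia.
  + by rewrite (vp pv') (vn pv') mul1n muln1 in trim trin *; lia.
- by move=> C3; rewrite sumL C3 /=; lia.
move=> lt3; rewrite sumL; case: ifP => [oddC | evenC].
  have : 4 < #|C| by move: lt3; rewrite leq_eqVlt => /predU1P[e|//]; rewrite -e in oddC.
  nia.
nia.
Qed.

Lemma sum_over_blocks (H : {set G} -> int) (b : int) :
  (forall f, f \in edges G -> (forall C, C \in cycles G -> f \notin C) ->
     0 <= H f ?= iff peripheral_edge f)%R ->
  (forall C, C \in cycles G ->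
     b <= \sum_(f in C) H f ?= iff [forall f in C, peripheral_edge f])%R ->
  (b *+ #|cycles G| <= \sum_(f in edges G) H f ?= iff
     [forall f in edges G, peripheral_edge f])%R.
Proof.
move=> bridgeH cycleH; set K := cover (cycles G).
have sK : K \subset edges G by apply/bigcupsP=> C; apply: cycles_sub_edges.
have triv : trivIset (cycles G).
  apply/trivIsetP=> C1 C2 C1c C2c; apply: contraNT.
  by case/pred0Pn=> f /andP[f1 f2]; apply/eqP; apply: ed f1 f2.
rewrite (big_setID K) /= (setIidPr sK) (big_trivIset _ triv) /=.
rewrite -[X in (X <= _ ?= iff _)%R]addr0.
rewrite (_ : [forall f in edges G, _] =
  [forall C in cycles G, [forall f in C, peripheral_edge f]]
  && [forall f in edges G :\: K, peripheral_edge f]).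
  apply: leifD; first by rewrite -sumr_const; apply: leif_sum.
  apply: leif_0_sum => f /setDP[fE fK]; apply: bridgeH => // C Cc.
  by apply: contra fK => fC; apply/bigcupP; exists C.
apply/forall_inP/andP => [per | [/forall_inP perK /forall_inP perD] f fE].
  split; last by apply/forall_inP=> f /setDP[/per].
  apply/forall_inP=> C Cc; apply/forall_inP=> f fC; apply: per.
  exact: (subsetP (cycles_sub_edges Cc)).
have [/bigcupP[C Cc fC] | fK] := boolP (f \in K).
  by have /forall_inP-> := perK C Cc.
by apply: perD; apply/setDP.
Qed.

Lemma Sz_e_bound :
  ((2 * m%:Z - 3) *+ #|cycles G| <= (Sz_e G)%:Z ?= iff
   [forall f in edges G, peripheral_edge f])%R.
Proof.
rewrite /Sz_e (sum_edge_weight sz_e_term) -sum_Posz.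
by apply: sum_over_blocks; [exact: bridge_sz_e | exact: cycle_sz_e].
Qed.

Lemma Sz_ev_bound :
  (m%:Z * (m%:Z - 1) + (2 * n%:Z - m%:Z - 3) *+ #|cycles G| <=
   (\sum_(u : G) \sum_(v : G | adj u v && (enum_rank u < enum_rank v))
      (nv u v * me v u + nv v u * me u v))%N%:Z ?= iff
   [forall f in edges G, peripheral_edge f])%R.
Proof.
rewrite (sum_edge_weight sz_ev_term) -sum_Posz.
have := sum_over_blocks bridge_sz_ev cycle_sz_ev; rewrite sumrB sumr_const => -[le eq].
move: le eq; set S := (\sum_(i in _) _)%R; set B := (_ *+ #|cycles G|)%R.
rewrite -[((_ - 1) *+ _)%R]mulr_natl natz => le eq; split; first by move: le; lia.
by rewrite -eq; apply/eqP/eqP; lia.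
Qed.
End Bounds.

(** * The extremal graph *)

Section Extremal.
Variable G : sgraph.
Implicit Types (u v w x y z c : G) (f g : {set G}) (C : {set {set G}}).

Lemma isomorphic_C0_peripheral n k f : isomorphic G (C0 n k) ->
  f \in edges G -> peripheral_edge f.
Proof.
case=> h [h' hK h'K] adjh /edgesP[x [y [xy ->]]].
rewrite peripheral_edge_set2.
have per z s : h z = Some s -> peripheral z.
  case: s => [[i b]|j] hz.
    apply: (@peripheralI _ _ (h' None) (h' (Some (inl (i, ~~ b))))).
      by rewrite -adjh !h'K.
    move=> w; rewrite -adjh hz; have := hK w.
    case: (h w) => [[[j c]|j]|] <- //=; last by left.
    case/andP=> /eqP <- neq; right; congr (h' (Some (inl (_, _)))).
    by case: b c neq {hz} => [] [].
  apply: (@peripheral_leaf _ _ (h' None)) => w; rewrite -adjh hz; have := hK w.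
  by case: (h w) => [[[j' c]|j']|] <-.
move: xy; rewrite -adjh.
case hx: (h x) => [s|]; first by rewrite (per x s).
by case hy: (h y) => [s|] //; rewrite (per y s) ?orbT.
Qed.

Hypothesis conn : forall x y, connect (@adj G) x y.

(** Let x be a neighbour of c and z another neighbour of x. Since x is peripheral,
    c and z are adjacent; hence c and its neighbours form a whole component. *)
Lemma peripheral_nbrs_universal c : (forall x, adj c x -> peripheral x) ->
  forall y, y != c -> adj c y.
Proof.
move=> per y neq; have step x z : adj x z ->
    (x == c) || adj c x -> (z == c) || adj c z.
  move=> xz /orP[/eqP<- | cx]; first by rewrite xz orbT.
  have [//|neq_z] := eqVneq z c.
  by apply: (peripheral_adj (per x cx)) => //; rewrite 1?adj_sym // eq_sym.
have cl : closed (@adj G) [pred x | (x == c) || adj c x].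
  move=> x z xz; rewrite !inE; apply/idP/idP; apply: step => //.
  by rewrite adj_sym.
have := closed_connect cl (conn c y); rewrite !inE eqxx (negPf neq).
by move/esym.
Qed.

(** Any vertex that is not peripheral serves as c. If all vertices are peripheral,
    then every vertex is adjacent to all others, which leaves at most three
    vertices. *)
Lemma peripheral_edges_center : 3 < #|G| ->
  (forall f, f \in edges G -> peripheral_edge f) ->
  exists c, forall v, v != c -> adj c v /\ peripheral v.
Proof.
move=> hn pe; have [/existsP[c npc] | /existsPn allp] :=
    boolP [exists c : G, ~~ peripheral c].
  have per x : adj c x -> peripheral x.
    rewrite -mem_edges => /pe; rewrite peripheral_edge_set2.
    by rewrite (negPf npc).
  exists c => v /(peripheral_nbrs_universal per) cv; split=> //; exact: per.
have /card_gt0P[c _] : 0 < #|G| by apply: leq_trans hn.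
have univ := @peripheral_nbrs_universal c (fun x _ => negPn (allp x)).
have : #|G| <= #|c |: nbhd c|.
  apply/subset_leq_card/subsetP=> x _; rewrite !inE.
  by have [//|/univ] := eqVneq x c.
have /andP[le2 _] := negPn (allp c).
rewrite cardsU1 => le; have := leq_trans hn le.
by rewrite -(leq_add2l (c \notin nbhd c)) in le2; case: (_ \notin _) le2; lia.
Qed.

(** The edges M off the center form a matching, because each end of such an edge
    is also adjacent to c and has degree at most 2. There are n - 1 edges at c,
    so M has k members. The isomorphism is built from C0 to G: it enumerates M
    for the triangles and the unmatched vertices U for the pendant edges. *)
Lemma center_isomorphic k c : #|G| + k = (#|edges G|).+1 ->
  (forall v, v != c -> adj c v /\ peripheral v) ->
  isomorphic G (C0 #|G| k).
Proof.
move=> edge_count center.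
have cadj v : v != c -> adj c v by move/center=> [].
pose M := [set f in edges G | c \notin f].
have ME f : f \in M -> exists x y, [/\ adj x y, x != c, y != c & f = [set x; y]].
  rewrite in_set => /andP[/edgesP[x [y [xy ef]]]].
  rewrite ef !inE negb_or => /andP[xc yc]; exists x, y.
  by rewrite ![_ == c]eq_sym.
have Mxy x y : x != c -> y != c -> ([set x; y] \in M) = adj x y.
  move=> xc yc; rewrite in_set mem_edges !inE ![c == _]eq_sym.
  by rewrite (negPf xc) (negPf yc) andbT.
have cardM : #|M| = k.
  have : #|edges G| = #|M| + #|[set~ c]|.
    rewrite addnC -(cardsID [set f : {set G} | c \in f] (edges G)); congr (_ + _).
      rewrite -(@card_in_imset _ _ (fun v => [set c; v])).
        apply: eq_card => f; rewrite in_setI in_set; apply/andP/imsetP => [[]|[v]].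
          case/edgesP=> x [y [xy ->]] /set2P[]->.
            by exists y; rewrite // !inE eq_sym adj_neq.
          by exists x; rewrite 1?setUC // !inE adj_neq.
        by rewrite in_setC1 => vc ->; rewrite mem_edges set21 cadj.
      by move=> u v; rewrite !inE => uc vc /set2_eq[[]//|[-> //]].
    by apply: eq_card => f; rewrite in_setD !in_set andbC.
  by rewrite cardsC1; have : 0 < #|G| by [apply/card_gt0P; exists c]; lia.
have Minj f g x : f \in M -> g \in M -> x \in f -> x \in g -> f = g.
  have other f1 : f1 \in M -> x \in f1 ->
    exists y, [/\ adj x y, x != c, y != c & f1 = [set x; y]].
    case/ME=> a [b [ab ac bc ->]] /set2P[]->; first by exists b.
    by exists a; rewrite adj_sym setUC.
  move=> fM gM /(other _ fM)[y [xy xc yc ->]] /(other _ gM)[z [xz _ zc ->]].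
  have [-> //|neq] := eqVneq y z.
  have [_ /andP[le2 _]] := center x xc.
  suff : [set c; y; z] \subset nbhd x.
    move/subset_leq_card/leq_trans/(_ le2).
    by rewrite -setUA !cardsU1 cards1 !inE ![c == _]eq_sym (negPf yc) (negPf zc) neq.
  apply/subsetP=> w; rewrite !inE => /orP[/orP[]|] /eqP-> //.
  by rewrite adj_sym cadj.
have trivM : trivIset M.
  apply/trivIsetP=> f g fM gM; apply: contraNT.
  by case/pred0Pn=> x /andP[xf xg]; apply/eqP; apply: Minj xf xg.
have cardcM : #|cover M| = 2 * k.
  move: trivM; rewrite /trivIset => /eqP <-.
  rewrite mulnC -cardM -sum_nat_const; apply: eq_bigr => f.
  by case/ME=> x [y [xy _ _ ->]]; rewrite cards2 adj_neq.
pose U := ~: (c |: cover M).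
have ccM : c \notin cover M.
  by apply/bigcupP=> -[f]; rewrite in_set => /andP[_ /negP].
have cardU : #|U| = #|G| - 2 * k - 1.
  by have := cardsC (c |: cover M); rewrite cardsU1 ccM cardcM -/U; lia.
pose el1 f := odflt c [pick x in f]; pose el2 f := odflt c [pick x in f :\ el1 f].
have pairP f : f \in M -> [/\ el1 f \in f, el2 f \in f & adj (el1 f) (el2 f)].
  move=> /ME[x [y [xy _ _ ef]]].
  have pair a b : a \in f -> b \in f -> b != a -> adj a b.
    rewrite ef => /set2P[]-> /set2P[] ->; by rewrite ?eqxx // adj_sym.
  have el1f : el1 f \in f.
    by rewrite /el1; case: pickP => // /(_ x); rewrite ef set21.
  have /setD1P[neq el2f] : el2 f \in f :\ el1 f.
    rewrite {1}/el2; case: pickP => // none.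
    have := none x; have := none y; rewrite !in_setD1 ef set21 set22 !andbT.
    by move/negbFE/eqP=> <- /negbFE/eqP exy; rewrite exy adj_irrefl in xy.
  by split=> //; apply: pair.
pose elt f (b : bool) := if b then el1 f else el2 f.
have eltP f b : f \in M -> [/\ elt f b \in f, elt f b != c & adj (elt f b) (elt f (~~ b))].
  move=> fM; have [e1 e2 a] := pairP f fM.
  have inf : elt f b \in f by rewrite /elt; case: b.
  split=> //; last by rewrite /elt; case: b {inf}; rewrite //= adj_sym.
  by apply: contraNneq ccM => <-; apply/bigcupP; exists f.
pose nM i := nth set0 (enum M) i.
have nMP (i : 'I_k) : nM i \in M by rewrite -mem_enum mem_nth // -cardE cardM.
have nM_inj (i j : 'I_k) : nM i = nM j -> i = j.
  by move/eqP; rewrite nth_uniq ?enum_uniq -?cardE ?cardM // => /eqP/val_inj.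
pose nU j := nth c (enum U) j.
have nUP (j : 'I_(#|G| - 2 * k - 1)) : nU j \in U.
  by rewrite -mem_enum mem_nth // -cardE cardU.
have nU_inj (i j : 'I_(#|G| - 2 * k - 1)) : nU i = nU j -> i = j.
  by move/eqP; rewrite nth_uniq ?enum_uniq -?cardE ?cardU // => /eqP/val_inj.
have UP x : x \in U -> x != c /\ x \notin cover M.
  by rewrite !inE negb_or => /andP.
pose g (a : C0 #|G| k) : G := match a with
  | None => c
  | Some (inl (i, b)) => elt (nM i) b
  | Some (inr j) => nU j
  end.
have g_neq s : g (Some s) != c.
  by case: s => [[i b]|j] /=; [case: (eltP _ b (nMP i)) | case: (UP _ (nUP j))].
have adj_c v : adj c v = (v != c).
  by apply/idP/idP => [cv | /cadj //]; rewrite eq_sym adj_neq.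
have nadjU x y : x \in U -> y != c -> adj x y = false.
  move=> /UP[xc xM] yc; apply: contraNF xM => xy.
  by apply/bigcupP; exists [set x; y]; rewrite ?set21 // Mxy.
have adjg a b : adj (g a) (g b) = adj a b.
  case: a b => [s|] [t|]; last by rewrite /= !adj_irrefl.
  - case: s t => [[i b]|j] [[i' b']|j'].
    + have [_ ec ee] := eltP _ b (nMP i).
      have [inf' ec' _] := eltP _ b' (nMP i').
      have [inf _ _] := eltP _ b (nMP i).
      rewrite [RHS]/=; apply/idP/andP => [a | [/eqP <- neq]].
        have aM : [set g (Some (inl (i, b))); g (Some (inl (i', b')))] \in M.
          by rewrite Mxy ?g_neq.
        have e1 := Minj _ _ _ aM (nMP i) (set21 _ _) inf.
        have e2 := Minj _ _ _ aM (nMP i') (set22 _ _) inf'.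
        have ei : i = i' by apply: nM_inj; rewrite -e1 -e2.
        rewrite ei eqxx; split=> //; apply: contraTneq a => ->.
        by rewrite ei /= adj_irrefl.
      by rewrite /=; have -> : b' = ~~ b by case: b b' neq {ee inf ec inf' ec'} => [] [].
    + by rewrite adj_sym (nadjU _ _ (nUP j')) ?g_neq.
    + by rewrite (nadjU _ _ (nUP j)) ?g_neq.
    by rewrite (nadjU _ _ (nUP j)) ?g_neq.
  - by rewrite adj_sym adj_c g_neq; case: s => [[]|].
  by rewrite adj_c g_neq; case: t => [[]|].
have g_inj : injective g.
  move=> [s|] [t|] //; first last.
  - by move/esym/eqP; rewrite (negPf (g_neq _)).
  - by move/eqP; rewrite (negPf (g_neq _)).
  case: s t => [[i b]|j] [[i' b']|j'] /= e.
  - have [inf _ nadj] := eltP _ b (nMP i); have [inf' _ _] := eltP _ b' (nMP i').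
    rewrite -e in inf'; have ei := nM_inj _ _ (Minj _ _ _ (nMP i) (nMP i') inf inf').
    rewrite -ei in e *; congr (Some (inl (_, _))); apply/eqP.
    apply: contraTT nadj => neq; have -> : ~~ b = b'.
      by case: b b' neq {e inf inf'} => [] [].
    by rewrite e adj_irrefl.
  - have [inf _ _] := eltP _ b (nMP i); have [_ /negP[]] := UP _ (nUP j').
    by rewrite -e; apply/bigcupP; exists (nM i).
  - have [inf _ _] := eltP _ b' (nMP i'); have [_ /negP[]] := UP _ (nUP j).
    by rewrite e; apply/bigcupP; exists (nM i').
  by rewrite (nU_inj _ _ e).
(* An injection is enough, as C0 has at least #|G| vertices. *)
have [g' gK g'K] : bijective g.
  apply: (inj_card_bij g_inj); rewrite card_option card_sum card_prod card_bool !card_ord.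
  lia.
by exists g' => [|x y]; [exists g | rewrite -adjg !g'K].
Qed.
End Extremal.

Local Open Scope ring_scope.

Theorem theorem1p1 (n k : nat) (hn : (5 <= n)%N) (G : sgraph)
    (hG : cactus_class n k G) :
  let be : rat := 2 * k%:R * n%:R + 2 * k%:R ^+ 2 - 5 * k%:R in
  let bev : rat :=
    (n%:R ^+ 2 - 3 * n%:R + 3 * k%:R * n%:R - 5 * k%:R + 2) / 2 in
  [/\ be <= (Sz_e G)%:R,
      bev <= Sz_ev G,
      (Sz_e G)%:R = be <-> isomorphic G (C0 n k)
    & Sz_ev G = bev <-> isomorphic G (C0 n k)].
Proof.
move=> be bev; have [cactG cardV cardC] := hG; have [connG _] := cactG.
have conn x y : connect (@adj G) x y.
  have := connected_onP _ connG x y (in_setT _) (in_setT _).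
  by apply: connect_sub => u v /and3P[_ _ uv]; apply: connect1.
have ed : edge_disjoint_cycles G.
  by move=> C1 C2 f; apply: cactus_cycles_edge_disjoint.
have hn' : (5 <= #|G|)%N by rewrite cardV.
have [r _] : exists r : G, r \in G by apply/card_gt0P; apply: leq_trans hn'.
have cardE := card_edges_cactus ed conn r.
have [le_e eq_e] := Sz_e_bound conn ed hn'.
have [le_ev eq_ev] := Sz_ev_bound conn ed hn'.
set S := (\sum_(u : G) _)%N in le_ev eq_ev.
rewrite cardV cardC in cardE le_e eq_e le_ev eq_ev.
have extremal : [forall f in edges G, peripheral_edge f] <-> isomorphic G (C0 n k).
  split=> [/forall_inP pe | iso]; last first.
    by apply/forall_inP=> f; apply: isomorphic_C0_peripheral iso.
  have [c center] := peripheral_edges_center conn (ltnW hn') pe.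
  by rewrite -cardV; apply: center_isomorphic center; rewrite cardV.
have {}cardE : (#|edges G|%:Z = n%:Z + k%:Z - 1) by lia.
set me := #|edges G| in cardE le_e eq_e le_ev eq_ev.
have beE : be = ((2 * me%:Z - 3) *+ k)%:~R.
  by rewrite cardE -mulr_natr !rmorphM /= !rmorphB /= rmorphM /= rmorphB rmorphD /=
    -!pmulrn natz; rewrite /be -?pmulrn; ring.
have bevE : bev = (me%:Z * (me%:Z - 1) + (2 * n%:Z - me%:Z - 3) *+ k)%:~R / 2.
  rewrite cardE -mulr_natr natz /bev; congr (_ / _).
  by rewrite rmorphD !rmorphM /= !rmorphB /= rmorphM /= !rmorphD /= -!pmulrn; ring.
have SevE : Sz_ev G = S%:Z%:~R / 2 by rewrite -pmulrn.
have SeE : (Sz_e G)%:R = (Sz_e G)%:Z%:~R :> rat by rewrite -pmulrn.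
have tight (a b : int) : (a == b) = [forall f in edges G, peripheral_edge f] ->
    b = a <-> isomorphic G (C0 n k).
  move=> eq_ab; split=> [e | /(proj2 extremal)]; last by rewrite -eq_ab => /eqP.
  by apply: (proj1 extremal); rewrite -eq_ab e.
have half_gt0 : 0 < 2^-1 :> rat by rewrite invr_gt0.
split.
- by rewrite beE SeE ler_int.
- by rewrite bevE SevE (ler_pM2r half_gt0) ler_int.
- rewrite beE SeE -(tight _ _ eq_e).
  by split=> [/intr_inj | ->].
rewrite bevE SevE -(tight _ _ eq_ev).
by split=> [/(mulIf (lt0r_neq0 half_gt0))/intr_inj | ->].
Qed.
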